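(* Let $R$ be a commutative artin ring, $\mathcal{C}$ a dualizing $R$-variety with cokernels, $P=\mathrm{Hom}_{\mathcal{C}}(C,-)\in\mathrm{mod}(\mathcal{C})$ and $\mathcal{I}=\mathrm{Tr}_P\mathcal{C}$. If $\mathcal{I}(C',-)$ is projective for all $C'\in\mathcal{C}$, then $R_{P}=\mathrm{End}_{\mathrm{mod}(\mathcal{C})}(P)^{op}$ is quasi-hereditary.
   Context: A Hom-finite $R$-variety is a small additive category in which idempotents split, whose Hom-sets are finitely generated $R$-modules with $R$-bilinear composition. $\mathrm{Mod}(\mathcal{C})$ is the category of additive functors $\mathcal{C}\to\mathbf{Ab}$ and $\mathrm{mod}(\mathcal{C})$ its full subcategory of finitely presented functors. With $E$ the injective envelope of $R/\mathrm{rad}(R)$, put $\mathbb{D}_{\mathcal{C}}(M)(X)=\mathrm{Hom}_R(M(X),E)$ for functors with finitely generated values; $\mathcal{C}$ is dualizing if $\mathbb{D}_{\mathcal{C}}$ induces a duality between $\mathrm{mod}(\mathcal{C})$ and $\mathrm{mod}(\mathcal{C}^{op})$. ''With cokernels'' means that every morphism of $\mathcal{C}$ has a cokernel in $\mathcal{C}$. The trace ideal $\mathrm{Tr}_P\mathcal{C}$ is $(\mathrm{Tr}_P\mathcal{C})(A,B)=\mathrm{Tr}_P(\mathrm{Hom}_{\mathcal{C}}(A,-))(B)$, where $\mathrm{Tr}_P(N)\subseteq N$ is the sum of the images of all morphisms $P\to N$. $R_P$ is an artin $R$-algebra, and ''quasi-hereditary'' is the usual notion for artin algebras. *)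

(* Defs.v *)
From HB Require Import structures.
From mathcomp Require Import all_boot all_algebra.
From mathcomp Require Import boolp classical_sets.

Set Implicit Arguments.
Unset Strict Implicit.
Unset Printing Implicit Defensive.

Import GRing.Theory.
Local Open Scope classical_set_scope.
Local Open Scope ring_scope.

(* Left ideals of A are the submodules of the regular module A^o.  Rings may
   be zero (pzRingType): End(Hom(C,-)) is zero when C is a zero object. *)

Definition commutative_artin (R : comPzRingType) : Prop :=
  forall I : nat -> submodClosed R^o,
    (forall n, {subset I n.+1 <= I n}) ->
    exists N, forall n, (N <= n)%N -> I n =i I N.

Definition maximal_left_ideal (A : pzRingType) (M : submodClosed A^o) : Prop :=
  1 \notin M /\
  forall L : submodClosed A^o,
    {subset M <= L} -> 1 \notin L -> {subset L <= M}.

(* Jacobson radical: intersection of the maximal left ideals. *)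
Definition rad (A : pzRingType) : set A :=
  [set x | forall M : submodClosed A^o, maximal_left_ideal M -> x \in M].

Definition fin_gen (A : pzRingType) (M : lmodType A) : Prop :=
  exists n (g : 'I_n -> M),
    forall x : M, exists c : 'I_n -> A, x = \sum_i c i *: g i.

Definition injective_module (A : pzRingType) (E : lmodType A) : Prop :=
  forall (M N : lmodType A) (i : {linear M -> N}) (f : {linear M -> E}),
    injective i -> exists g : {linear N -> E}, forall x, g (i x) = f x.

Definition projective_module (A : pzRingType) (Q : lmodType A) : Prop :=
  forall (M N : lmodType A) (p : {linear M -> N}) (f : {linear Q -> N}),
    (forall y, exists x, p x = y) ->
    exists g : {linear Q -> M}, forall x, p (g x) = f x.

Definition essential_mono (A : pzRingType) (M E : lmodType A)
    (i : {linear M -> E}) : Prop :=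
  injective i /\
  forall S : submodClosed E, (exists2 x, x \in S & x != 0) ->
    exists2 y, i y \in S & i y != 0.

Definition injective_envelope (A : pzRingType) (M E : lmodType A) : Prop :=
  injective_module E /\ exists i : {linear M -> E}, essential_mono i.

(* Q is (isomorphic to) the quotient module M/S. *)
Definition is_quotient_module (A : pzRingType) (M Q : lmodType A) (S : set M) :
    Prop :=
  exists p : {linear M -> Q},
    (forall y, exists x, p x = y) /\ (forall x, p x = 0 <-> S x).

Section SubModule.
Variables (A : pzRingType) (M : lmodType A) (S : submodClosed M).

Definition submodule : Type := {x : M | x \in S}.

HB.instance Definition _ := SubChoice.on submodule.
HB.instance Definition _ := [SubChoice_isSubLmodule of submodule by <:].

End SubModule.

Definition two_sided (A : pzRingType) (J : submodClosed A^o) : Prop :=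
  forall x a : A, x \in J -> x * a \in J.

Definition idempotent_ideal (A : pzRingType) (J : submodClosed A^o) : Prop :=
  forall x : A, x \in J ->
    exists n (a b : 'I_n -> A),
      (forall i, a i \in J /\ b i \in J) /\ x = \sum_i a i * b i.

(* Projectivity is asked of J as a left module; for a semiprimary ring and J
   with the other properties this is equivalent to right projectivity. *)
Definition heredity_ideal (A : pzRingType) (J : submodClosed A^o) : Prop :=
  [/\ two_sided J,
      idempotent_ideal J,
      forall x n y : A, x \in J -> rad n -> y \in J -> x * n * y = 0 &
      projective_module (submodule J)].

(* J' / J is a heredity ideal of A / J: the quotient ring is given by a
   surjective morphism pi with kernel J, and H is the image of J' in it. *)
Definition heredity_step (A : pzRingType) (J J' : submodClosed A^o) : Prop :=
  exists (B : pzRingType) (pi : {rmorphism A -> B}) (H : submodClosed B^o),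
    [/\ forall b, exists a, pi a = b,
        forall a, pi a = 0 <-> a \in J,
        forall b, b \in H <-> exists2 a, a \in J' & pi a = b &
        heredity_ideal H].

(* Heredity chain 0 = J_0 <= J_1 <= ... <= J_m = A of two-sided ideals. *)
Definition quasi_hereditary (A : pzRingType) : Prop :=
  exists (m : nat) (J : nat -> submodClosed A^o),
    [/\ forall t, (t <= m)%N -> two_sided (J t),
        forall x, x \in J 0%N <-> x = 0,
        forall x, x \in J m,
        forall t, (t < m)%N -> {subset J t <= J t.+1} &
        forall t, (t < m)%N -> heredity_step (J t) (J t.+1)].

(* R-bilinear composition; comp g f is g after f. *)
Record rcategory (R : comPzRingType) := RCategory {
  obj :> Type;
  hom : obj -> obj -> lmodType R;
  id1 : forall X, hom X X;
  comp : forall X Y Z, hom Y Z -> hom X Y -> hom X Z;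
  comp1l : forall X Y (f : hom X Y), comp (id1 Y) f = f;
  comp1r : forall X Y (f : hom X Y), comp f (id1 X) = f;
  compA : forall X Y Z W (h : hom Z W) (g : hom Y Z) (f : hom X Y),
    comp h (comp g f) = comp (comp h g) f;
  comp_linearl : forall X Y Z (f : hom X Y), linear (fun g : hom Y Z => comp g f);
  comp_linearr : forall X Y Z (g : hom Y Z), linear (fun f : hom X Y => comp g f)
}.
Arguments hom {R} C X Y : rename.
Arguments id1 {R} C X : rename.
Arguments comp {R} C {X Y Z} g f : rename.

Section RCategory.
Variables (R : comPzRingType) (C : rcategory R).

Lemma compDl (X Y Z : C) (g g' : hom C Y Z) (f : hom C X Y) :
  comp C (g + g') f = comp C g f + comp C g' f.
Proof. by have := comp_linearl f 1 g g'; rewrite !scale1r. Qed.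

Lemma compDr (X Y Z : C) (g : hom C Y Z) (f f' : hom C X Y) :
  comp C g (f + f') = comp C g f + comp C g f'.
Proof. by have := comp_linearr g 1 f f'; rewrite !scale1r. Qed.

Lemma comp0l (X Y Z : C) (f : hom C X Y) : comp C (0 : hom C Y Z) f = 0.
Proof. by apply: (addrI (comp C 0 f)); rewrite -compDl !addr0. Qed.

Lemma comp0r (X Y Z : C) (g : hom C Y Z) : comp C g (0 : hom C X Y) = 0.
Proof. by apply: (addrI (comp C g 0)); rewrite -compDr !addr0. Qed.

Lemma compZl (X Y Z : C) a (g : hom C Y Z) (f : hom C X Y) :
  comp C (a *: g) f = a *: comp C g f.
Proof. by have := comp_linearl f a g 0; rewrite comp0l !addr0. Qed.

Lemma compZr (X Y Z : C) a (g : hom C Y Z) (f : hom C X Y) :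
  comp C g (a *: f) = a *: comp C g f.
Proof. by have := comp_linearr g a f 0; rewrite comp0r !addr0. Qed.

Definition rcat_op : rcategory R :=
  @RCategory R (obj C) (fun X Y => hom C Y X) (id1 C)
    (fun X Y Z g f => comp C f g)
    (fun X Y f => comp1r f) (fun X Y f => comp1l f)
    (fun X Y Z W h g f => esym (compA f g h))
    (fun X Y Z f => comp_linearr f) (fun X Y Z g => comp_linearl g).

Definition is_zero_object (Z : C) : Prop := id1 C Z = 0.

Definition is_biproduct (X Y S : C) : Prop :=
  exists (i : hom C X S) (j : hom C Y S) (p : hom C S X) (q : hom C S Y),
    [/\ comp C p i = id1 C X, comp C q j = id1 C Y,
        comp C p j = 0, comp C q i = 0 &
        comp C i p + comp C j q = id1 C S].

Definition additive_category : Prop :=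
  (exists Z : C, is_zero_object Z) /\
  (forall X Y : C, exists S : C, is_biproduct X Y S).

Definition idempotents_split : Prop :=
  forall (X : C) (e : hom C X X), comp C e e = e ->
    exists (Y : C) (s : hom C Y X) (r : hom C X Y),
      comp C s r = e /\ comp C r s = id1 C Y.

Definition hom_finite_variety : Prop :=
  [/\ additive_category, idempotents_split &
      forall X Y : C, fin_gen (hom C X Y)].

Definition is_cokernel (X Y K : C) (f : hom C X Y) (c : hom C Y K) : Prop :=
  comp C c f = 0 /\
  forall (W : C) (h : hom C Y W), comp C h f = 0 ->
    exists! u : hom C K W, comp C u c = h.

Definition with_cokernels : Prop :=
  forall (X Y : C) (f : hom C X Y),
    exists (K : C) (c : hom C Y K), is_cokernel f c.

End RCategory.

Lemma additive_ext (U V : zmodType) (f g : {additive U -> V}) :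
  (forall x, f x = g x) -> f = g.
Proof.
case: f => f [[f0]]; case: g => g [[g0]] /= fg.
have {fg}E : f = g by apply/funext.
by case: _ / E g0 => g0; rewrite (Prop_irrelevance f0 g0).
Qed.

Section Functors.
Variables (R : comPzRingType) (C : rcategory R).

(* Additive functors C -> Ab; Mod(C) has nattrans as morphisms. *)
Record afunctor := AFunctor {
  fobj :> C -> zmodType;
  fmap : forall X Y, hom C X Y -> {additive fobj X -> fobj Y};
  fmap1 : forall X x, fmap (id1 C X) x = x;
  fmap_comp : forall X Y Z (g : hom C Y Z) (f : hom C X Y) x,
    fmap (comp C g f) x = fmap g (fmap f x);
  fmapD : forall X Y (f g : hom C X Y) x,
    fmap (f + g) x = fmap f x + fmap g x
}.

Record nattrans (F G : afunctor) := NatTrans {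
  nt :> forall X : C, {additive F X -> G X};
  nt_nat : forall X Y (f : hom C X Y) x,
    nt Y (fmap F f x) = fmap G f (nt X x)
}.

End Functors.
Arguments fmap {R C} F {X Y} f : rename.

Section NatTrans.
Variables (R : comPzRingType) (C : rcategory R).
Implicit Types F G H : afunctor C.

Lemma nattrans_ext F G (s t : nattrans F G) :
  (forall X x, s X x = t X x) -> s = t.
Proof.
case: s t => s sP [t tP] /= st.
have {st}E : s = t.
  by apply: functional_extensionality_dep => X; apply: additive_ext => x; apply: st.
by case: _ / E tP => tP; rewrite (Prop_irrelevance sP tP).
Qed.

Definition nt_id F : nattrans F F :=
  @NatTrans R C F F (fun X => idfun) (fun _ _ _ _ => erefl).

Lemma nt_comp_nat F G H (t : nattrans G H) (s : nattrans F G) X Y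
    (f : hom C X Y) x :
  (t Y \o s Y) (fmap F f x) = fmap H f ((t X \o s X) x).
Proof. by rewrite /= !nt_nat. Qed.

Definition nt_comp F G H (t : nattrans G H) (s : nattrans F G) : nattrans F H :=
  @NatTrans R C F H (fun X => t X \o s X) (nt_comp_nat t s).

Section Zmodule.
Variables F G : afunctor C.
Implicit Types s t u : nattrans F G.

HB.instance Definition _ := gen_eqMixin (nattrans F G).
HB.instance Definition _ := gen_choiceMixin (nattrans F G).

Lemma nt_zero_nat X Y (f : hom C X Y) x :
  (\0 : F Y -> G Y) (fmap F f x) = fmap G f ((\0 : F X -> G X) x).
Proof. by rewrite /= raddf0. Qed.

Definition nt_zero : nattrans F G :=
  @NatTrans R C F G (fun X => \0) nt_zero_nat.

Lemma nt_add_nat s t X Y (f : hom C X Y) x :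
  (s Y \+ t Y) (fmap F f x) = fmap G f ((s X \+ t X) x).
Proof. by rewrite /= !nt_nat raddfD. Qed.

Definition nt_add s t : nattrans F G :=
  @NatTrans R C F G (fun X => s X \+ t X) (nt_add_nat s t).

Lemma nt_opp_nat s X Y (f : hom C X Y) x :
  (\- s Y) (fmap F f x) = fmap G f ((\- s X) x).
Proof. by rewrite /= nt_nat raddfN. Qed.

Definition nt_opp s : nattrans F G :=
  @NatTrans R C F G (fun X => \- s X) (nt_opp_nat s).

Lemma nt_addA : associative nt_add.
Proof. by move=> s t u; apply: nattrans_ext => X x /=; rewrite addrA. Qed.
Lemma nt_addC : commutative nt_add.
Proof. by move=> s t; apply: nattrans_ext => X x /=; rewrite addrC. Qed.
Lemma nt_add0 : left_id nt_zero nt_add.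
Proof. by move=> s; apply: nattrans_ext => X x /=; rewrite add0r. Qed.
Lemma nt_addN : left_inverse nt_zero nt_opp nt_add.
Proof. by move=> s; apply: nattrans_ext => X x /=; rewrite addNr. Qed.

HB.instance Definition _ :=
  GRing.isZmodule.Build (nattrans F G) nt_addA nt_addC nt_add0 nt_addN.

End Zmodule.

Definition endo F : Type := nattrans F F.

Section Endo.
Variable F : afunctor C.
Implicit Types s t u : endo F.

HB.instance Definition _ := GRing.Zmodule.on (endo F).

Definition endo_mul s t : endo F := nt_comp s t.

Lemma endo_mulA : associative endo_mul.
Proof. by move=> s t u; apply: nattrans_ext. Qed.
Lemma endo_mul1 : left_id (nt_id F) endo_mul.
Proof. by move=> s; apply: nattrans_ext. Qed.
Lemma endo_mul1r : right_id (nt_id F) endo_mul.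
Proof. by move=> s; apply: nattrans_ext. Qed.
Lemma endo_mulDl : left_distributive endo_mul +%R.
Proof. by move=> s t u; apply: nattrans_ext. Qed.
Lemma endo_mulDr : right_distributive endo_mul +%R.
Proof. by move=> s t u; apply: nattrans_ext => X x /=; rewrite raddfD. Qed.

HB.instance Definition _ := GRing.Zmodule_isPzRing.Build (endo F)
  endo_mulA endo_mul1 endo_mul1r endo_mulDl endo_mulDr.

End Endo.

(* Epimorphisms of Mod(C) are the componentwise surjective transformations. *)
Definition nt_epi F G (p : nattrans F G) : Prop :=
  forall X y, exists x, p X x = y.

Definition projective_functor F : Prop :=
  forall M N (p : nattrans M N) (f : nattrans F N), nt_epi p ->
    exists g : nattrans F M, nt_comp p g = f.

End NatTrans.

Section Representable.
Variables (R : comPzRingType) (C : rcategory R) (A : C).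

Section Map.
Variables (X Y : C) (f : hom C X Y).
Definition rep_map (u : hom C A X) : hom C A Y := comp C f u.
Lemma rep_map_zmod : zmod_morphism rep_map.
Proof. by move=> u v; rewrite /rep_map compDr -scaleN1r compZr scaleN1r. Qed.
HB.instance Definition _ :=
  GRing.isZmodMorphism.Build (hom C A X) (hom C A Y) rep_map rep_map_zmod.
End Map.

(* Hom_C(A,-) *)
Definition rep : afunctor C :=
  @AFunctor R C (fun X => hom C A X) (fun X Y f => rep_map f)
    (fun X u => comp1l u) (fun X Y Z g f u => esym (compA g f u))
    (fun X Y f g u => compDl f g u).

End Representable.

(* Exact sequence Hom(B,-) -> Hom(A,-) -> M -> 0; in an additive category
   finite sums of representables are representable. *)
Definition finitely_presented (R : comPzRingType) (C : rcategory R)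
    (M : afunctor C) : Prop :=
  exists (A B : C) (p : nattrans (rep B) (rep A)) (q : nattrans (rep A) M),
    nt_epi q /\ forall X y, q X y = 0 <-> exists z, p X z = y.

Section Trace.
Variables (R : comPzRingType) (C : rcategory R) (P N : afunctor C).

Definition trace_set (X : C) : set (N X) :=
  [set y | exists n (phi : 'I_n -> nattrans P N) (x : 'I_n -> P X),
     y = \sum_i phi i X (x i)].

Definition trace_pred (X : C) : {pred N X} := fun y => `[< trace_set y >].

Lemma trace_zmod_closed X : zmod_closed (@trace_pred X).
Proof.
split=> [|y z /asboolP[n [phi [x ->]]] /asboolP[m [psi [w ->]]]].
  apply/asboolP; exists 0%N, (fun=> 0), (fun=> 0); by rewrite big_ord0.
apply/asboolP; exists (n + m)%N,
  (fun i => match split i with inl j => phi j | inr k => psi k end),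
  (fun i => match split i with inl j => x j | inr k => - w k end).
rewrite big_split_ord /= -sumrN; congr (_ + _); apply: eq_bigr => i _.
  by rewrite (unsplitK (inl i)).
by rewrite (unsplitK (inr i)) raddfN.
Qed.

HB.instance Definition _ X :=
  GRing.isZmodClosed.Build (N X) (@trace_pred X) (@trace_zmod_closed X).

Definition trace_obj (X : C) : Type := {y : N X | y \in @trace_pred X}.

HB.instance Definition _ X := SubChoice.on (trace_obj X).
HB.instance Definition _ X := [SubChoice_isSubZmodule of trace_obj X by <:].

Section Map.
Variables (X Y : C) (f : hom C X Y).

Lemma trace_map_proof (y : trace_obj X) : fmap N f (val y) \in @trace_pred Y.
Proof.
case: y => y /= /asboolP[n [phi [x ->]]]; apply/asboolP.
exists n, phi, (fun i => fmap P f (x i)).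
by rewrite raddf_sum; apply: eq_bigr => i _; rewrite nt_nat.
Qed.

Definition trace_map (y : trace_obj X) : trace_obj Y :=
  exist _ (fmap N f (val y)) (trace_map_proof y).

Lemma trace_map_zmod : zmod_morphism trace_map.
Proof. by move=> y z; apply: val_inj; rewrite /= !raddfB. Qed.

HB.instance Definition _ :=
  GRing.isZmodMorphism.Build (trace_obj X) (trace_obj Y) trace_map
    trace_map_zmod.
End Map.

Lemma trace_map1 X (y : trace_obj X) : trace_map (id1 C X) y = y.
Proof. by apply: val_inj; rewrite /= fmap1. Qed.

Lemma trace_map_comp X Y Z (g : hom C Y Z) (f : hom C X Y) y :
  trace_map (comp C g f) y = trace_map g (trace_map f y).
Proof. by apply: val_inj; rewrite /= fmap_comp. Qed.

Lemma trace_mapD X Y (f g : hom C X Y) y :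
  trace_map (f + g) y = trace_map f y + trace_map g y.
Proof. by apply: val_inj; rewrite /= fmapD. Qed.

Definition trace : afunctor C :=
  @AFunctor R C (fun X => trace_obj X) (fun X Y f => trace_map f)
    trace_map1 trace_map_comp trace_mapD.

End Trace.

(* trace_ideal P A is the functor (Tr_P C)(A,-), so that
   trace_ideal P A B is (Tr_P C)(A,B), inside Hom_C(A,B). *)
Definition trace_ideal (R : comPzRingType) (C : rcategory R) (P : afunctor C)
    (A : C) : afunctor C :=
  trace P (rep A).

(* Plain categories, kept apart from rcategory so that Mod(C) can live in a
   larger universe than C. *)
Record category := Category {
  ob :> Type;
  mor : ob -> ob -> Type;
  cidm : forall X, mor X X;
  ccomp : forall X Y Z, mor Y Z -> mor X Y -> mor X Z;
  ccomp1l : forall X Y (f : mor X Y), ccomp (cidm Y) f = f;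
  ccomp1r : forall X Y (f : mor X Y), ccomp f (cidm X) = f;
  ccompA : forall X Y Z W (h : mor Z W) (g : mor Y Z) (f : mor X Y),
    ccomp h (ccomp g f) = ccomp (ccomp h g) f
}.
Arguments mor : clear implicits.
Arguments cidm : clear implicits.
Arguments ccomp _ {X Y Z} g f : rename.

Definition cat_op (K : category) : category :=
  @Category (ob K) (fun X Y => mor K Y X) (cidm K)
    (fun X Y Z g f => ccomp K f g)
    (fun X Y f => ccomp1r f) (fun X Y f => ccomp1l f)
    (fun X Y Z W h g f => esym (ccompA f g h)).

Record functor (K L : category) := Functor {
  fun_ob :> K -> L;
  fun_mor : forall X Y, mor K X Y -> mor L (fun_ob X) (fun_ob Y);
  fun_id : forall X, fun_mor (cidm K X) = cidm L (fun_ob X);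
  fun_comp : forall X Y Z (g : mor K Y Z) (f : mor K X Y),
    fun_mor (ccomp K g f) = ccomp L (fun_mor g) (fun_mor f)
}.

Definition functor_id (K : category) : functor K K :=
  @Functor K K (fun X => X) (fun X Y f => f)
    (fun=> erefl) (fun _ _ _ _ _ => erefl).

Section Functor_comp.
Variables (K L M : category) (G : functor L M) (F : functor K L).

Lemma functor_comp_id X : fun_mor G (fun_mor F (cidm K X)) = cidm M (G (F X)).
Proof. by rewrite !fun_id. Qed.

Lemma functor_comp_comp X Y Z (g : mor K Y Z) (f : mor K X Y) :
  fun_mor G (fun_mor F (ccomp K g f)) =
  ccomp M (fun_mor G (fun_mor F g)) (fun_mor G (fun_mor F f)).
Proof. by rewrite !fun_comp. Qed.

Definition functor_comp : functor K M :=
  @Functor K M (fun X => G (F X)) (fun X Y f => fun_mor G (fun_mor F f))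
    functor_comp_id functor_comp_comp.

End Functor_comp.

Definition is_iso (K : category) (X Y : K) (f : mor K X Y) : Prop :=
  exists g : mor K Y X, ccomp K g f = cidm K X /\ ccomp K f g = cidm K Y.

Definition naturally_isomorphic (K L : category) (F G : functor K L) : Prop :=
  exists eta : forall X : K, mor L (F X) (G X),
    (forall X Y (f : mor K X Y),
       ccomp L (eta Y) (fun_mor F f) = ccomp L (fun_mor G f) (eta X)) /\
    (forall X, is_iso (eta X)).

Definition is_equivalence (K L : category) (F : functor K L) : Prop :=
  exists G : functor L K,
    naturally_isomorphic (functor_comp G F) (functor_id K) /\
    naturally_isomorphic (functor_comp F G) (functor_id L).

Section FinPres.
Variables (R : comPzRingType) (C : rcategory R).

(* Together with nattrans, the objects of mod(C). *)
Definition fp_functor : Type := {M : afunctor C | finitely_presented M}.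

Lemma nt_comp1l (F G : afunctor C) (s : nattrans F G) :
  nt_comp (nt_id G) s = s.
Proof. exact: nattrans_ext. Qed.

Lemma nt_comp1r (F G : afunctor C) (s : nattrans F G) :
  nt_comp s (nt_id F) = s.
Proof. exact: nattrans_ext. Qed.

Lemma nt_compA (F G H K : afunctor C) (u : nattrans H K) (t : nattrans G H)
    (s : nattrans F G) :
  nt_comp u (nt_comp t s) = nt_comp (nt_comp u t) s.
Proof. exact: nattrans_ext. Qed.

Definition fp_cat : category :=
  @Category fp_functor (fun M N => nattrans (sval M) (sval N))
    (fun M => nt_id (sval M)) (fun M N K t s => nt_comp t s)
    (fun M N s => nt_comp1l s) (fun M N s => nt_comp1r s)
    (fun M N K L u t s => nt_compA u t s).

End FinPres.

(* The values of an additive functor are R-modules, r acting as M(r 1_X). *)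
Section RValue.
Variables (R : comPzRingType) (C : rcategory R) (M : afunctor C) (X : C).

Definition rval : Type := M X.

HB.instance Definition _ := GRing.Zmodule.on rval.

Definition rval_scale (r : R) (m : rval) : rval := fmap M (r *: id1 C X) m.

Lemma rval_scaleA a b m :
  rval_scale a (rval_scale b m) = rval_scale (a * b) m.
Proof. by rewrite /rval_scale -fmap_comp compZl comp1l scalerA. Qed.
Lemma rval_scale1 : left_id 1 rval_scale.
Proof. by move=> m; rewrite /rval_scale scale1r fmap1. Qed.
Lemma rval_scaleDr : right_distributive rval_scale +%R.
Proof. by move=> a m n; rewrite /rval_scale raddfD. Qed.
Lemma rval_scaleDl m : {morph rval_scale^~ m : a b / a + b}.
Proof. by move=> a b; rewrite /rval_scale scalerDl fmapD. Qed.

HB.instance Definition _ := GRing.Zmodule_isLmodule.Build R rval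
  rval_scaleA rval_scale1 rval_scaleDr rval_scaleDl.

End RValue.

Section RValueMaps.
Variables (R : comPzRingType) (C : rcategory R).

Section Map.
Variables (M : afunctor C) (X Y : C) (f : hom C X Y).
Definition rval_map (m : rval M X) : rval M Y := fmap M f m.
Lemma rval_map_linear : linear rval_map.
Proof.
move=> a m n; rewrite /rval_map raddfD; congr (_ + _).
by rewrite /GRing.scale /= /rval_scale -!fmap_comp compZl compZr comp1l comp1r.
Qed.
HB.instance Definition _ :=
  GRing.isLinear.Build R (rval M X) (rval M Y) _ rval_map rval_map_linear.
End Map.

Section NT.
Variables (M N : afunctor C) (s : nattrans M N) (X : C).
Definition rval_nt (m : rval M X) : rval N X := s X m.
Lemma rval_nt_linear : linear rval_nt.
Proof.
move=> a m n; rewrite /rval_nt raddfD; congr (_ + _).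
by rewrite /GRing.scale /= /rval_scale nt_nat.
Qed.
HB.instance Definition _ :=
  GRing.isLinear.Build R (rval M X) (rval N X) _ rval_nt rval_nt_linear.
End NT.

End RValueMaps.
Arguments rval_map {R C} M {X Y} f m.
Arguments rval_nt {R C M N} s X m.

(* Hom_R(U,V) as an abelian group. *)
Section LinHom.
Variables (R : comPzRingType) (U V : lmodType R).

Definition linhom : Type := {linear U -> V}.
Definition linhom_fun (f : linhom) : {linear U -> V} := f.
Coercion linhom_fun : linhom >-> GRing.Linear.type.

Implicit Types f g h : linhom.

Lemma linhom_ext f g : (forall x, f x = g x) -> f = g.
Proof.
rewrite /linhom_fun; case: f => f [[f0] [f1]]; case: g => g [[g0] [g1]] /= fg.
have {fg}E : f = g by apply/funext.
case: _ / E g0 g1 => g0 g1.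
by rewrite (Prop_irrelevance f0 g0) (Prop_irrelevance f1 g1).
Qed.

HB.instance Definition _ := gen_eqMixin linhom.
HB.instance Definition _ := gen_choiceMixin linhom.

Definition linhom_add f g : linhom := ((f : {linear U -> V}) \+ g : {linear U -> V}).
Definition linhom_opp f : linhom := (\- (f : {linear U -> V}) : {linear U -> V}).
Definition linhom_zero : linhom := (\0 : {linear U -> V}).

Lemma linhom_addA : associative linhom_add.
Proof. by move=> f g h; apply: linhom_ext => x /=; rewrite addrA. Qed.
Lemma linhom_addC : commutative linhom_add.
Proof. by move=> f g; apply: linhom_ext => x /=; rewrite addrC. Qed.
Lemma linhom_add0 : left_id linhom_zero linhom_add.
Proof. by move=> f; apply: linhom_ext => x /=; rewrite add0r. Qed.
Lemma linhom_addN : left_inverse linhom_zero linhom_opp linhom_add.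
Proof. by move=> f; apply: linhom_ext => x /=; rewrite addNr. Qed.

HB.instance Definition _ := GRing.isZmodule.Build linhom
  linhom_addA linhom_addC linhom_add0 linhom_addN.

End LinHom.

Section Precomp.
Variables (R : comPzRingType) (U W V : lmodType R) (t : {linear U -> W}).
Definition precomp (f : linhom W V) : linhom U V :=
  ((f : {linear W -> V}) \o t : {linear U -> V}).
Lemma precomp_zmod : zmod_morphism precomp.
Proof. by move=> f g; apply: linhom_ext. Qed.
HB.instance Definition _ :=
  GRing.isZmodMorphism.Build (linhom W V) (linhom U V) precomp precomp_zmod.
End Precomp.

Section Dual.
Variables (R : comPzRingType) (C : rcategory R) (E : lmodType R).

Section Objects.
Variable M : afunctor C.

Definition dual_map (X Y : rcat_op C) (f : hom (rcat_op C) X Y) :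
    {additive linhom (rval M X) E -> linhom (rval M Y) E} :=
  precomp (V := E) (rval_map M (f : hom C Y X)).

Lemma dual_map1 (X : rcat_op C) x : dual_map (id1 (rcat_op C) X) x = x.
Proof. by apply: linhom_ext => m /=; rewrite /rval_map fmap1. Qed.

Lemma dual_map_comp (X Y Z : rcat_op C) (g : hom (rcat_op C) Y Z)
    (f : hom (rcat_op C) X Y) x :
  dual_map (comp (rcat_op C) g f) x = dual_map g (dual_map f x).
Proof. by apply: linhom_ext => m /=; rewrite /rval_map fmap_comp. Qed.

Lemma dual_mapD (X Y : rcat_op C) (f g : hom (rcat_op C) X Y) x :
  dual_map (f + g) x = dual_map f x + dual_map g x.
Proof.
by apply: linhom_ext => m /=; rewrite /rval_map fmapD raddfD.
Qed.

(* D_C(M) : X |-> Hom_R(M(X),E) *)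
Definition dual : afunctor (rcat_op C) :=
  @AFunctor R (rcat_op C) (fun X => linhom (rval M X) E) dual_map
    dual_map1 dual_map_comp dual_mapD.

End Objects.

Section Morphisms.
Variables (M N : afunctor C) (s : nattrans M N).

Lemma dual_nt_nat (X Y : rcat_op C) (f : hom (rcat_op C) X Y) x :
  precomp (V := E) (rval_nt s Y) (fmap (dual N) f x) =
  fmap (dual M) f (precomp (V := E) (rval_nt s X) x).
Proof. by apply: linhom_ext => m /=; rewrite /rval_map /rval_nt nt_nat. Qed.

Definition dual_nt : nattrans (dual N) (dual M) :=
  @NatTrans R (rcat_op C) (dual N) (dual M)
    (fun X => precomp (V := E) (rval_nt s X)) dual_nt_nat.

End Morphisms.

Lemma dual_nt_id (M : afunctor C) : dual_nt (nt_id M) = nt_id (dual M).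
Proof. by apply: nattrans_ext => X x; apply: linhom_ext. Qed.

Lemma dual_nt_comp (M N K : afunctor C) (t : nattrans N K) (s : nattrans M N) :
  dual_nt (nt_comp t s) = nt_comp (dual_nt s) (dual_nt t).
Proof. by apply: nattrans_ext => X x; apply: linhom_ext. Qed.

Section Restriction.
Hypothesis fpD : forall M : afunctor C,
  finitely_presented M -> finitely_presented (dual M).

Definition fp_dual : functor (cat_op (fp_cat C)) (fp_cat (rcat_op C)) :=
  @Functor (cat_op (fp_cat C)) (fp_cat (rcat_op C))
    (fun M => exist _ (dual (sval M)) (fpD (svalP M)))
    (fun M N s => dual_nt s)
    (fun M => dual_nt_id (sval M))
    (fun M N K g f => dual_nt_comp f g).

End Restriction.

(* D_C restricts to a duality (contravariant equivalence)
   mod(C) -> mod(C^op). *)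
Definition dual_is_duality : Prop :=
  exists fpD : (forall M : afunctor C,
      finitely_presented M -> finitely_presented (dual M)),
    is_equivalence (fp_dual fpD).

End Dual.

(* Q is R / rad(R) and E is its injective envelope. *)
Definition dualizing_variety (R : comPzRingType) (C : rcategory R) : Prop :=
  hom_finite_variety C /\
  exists Q E : lmodType R,
    [/\ is_quotient_module (M := R^o) Q (@rad R),
        injective_envelope Q E &
        dual_is_duality C E].

(* Main.v *)
From HB Require Import structures.
From mathcomp Require Import all_boot all_algebra.
From mathcomp Require Import boolp classical_sets.
Require Import Defs.

Set Implicit Arguments.
Unset Strict Implicit.
Unset Printing Implicit Defensive.

Import GRing.Theory.
Local Open Scope classical_set_scope.
Local Open Scope ring_scope.

(** Write [G] for the opposite endomorphism ring of [P = Hom(C0,-)]. By Yoneda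
    it is [End(C0)] with composition as product. It is artinian, and finitely
    generated as a module over its centre, because [Hom(C0,C0)] is a finitely
    generated module over the commutative artinian ring [R].

    The ring [G] has global dimension at most two, in the form: kernels of maps
    between finitely generated free left modules are finitely generated
    projective ([endo_kernels_projective]). A map of free modules is given by
    some [f] between powers of [C0], and its kernel is [Hom(K,C0)] for [K] the
    cokernel of [f] in the category. Every map from [K] to [C0] belongs to the
    trace ideal [I], so a splitting of an epimorphism from [Hom(C0^n,-)] to
    [I(K,-)], evaluated at [C0], makes [Hom(K,C0)] a direct summand of [G^n]
    ([hom_dual_basis]).

    By a theorem of Dlab and Ringel, semiprimary rings of global dimension at
    most two are quasi-hereditary; [quasi_heredity] is the case at hand. Given
    such a nonzero ring [A], take a minimal nonzero finitely generated
    projective left ideal; it is isomorphic to [A e] with [e] idempotent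
    ([minimal_projective_idempotent]). The kernel of a nonzero map from [A e] to
    a free module is projective and smaller than [A e], hence zero. So [e A e]
    is a division ring, which makes [e r e] vanish for [r] in the radical, and
    [A e A] is a direct sum of copies of [A e]: it is a heredity ideal
    ([heredity_ideal_exists]).

    Finally [A / A e A] again has projective kernels
    ([kernels_projective_quotient]), so the construction can be repeated. It
    stops by the descending chain condition: a left ideal of the original ring
    that maps onto the current quotient can be shrunk at each step. *)

(** * Submodules and dual bases *)

Definition is_submod (A : pzRingType) (V : lmodType A) (K : set V) : Prop :=
  [/\ K 0, forall x y, K x -> K y -> K (x + y) &
      forall a x, K x -> K (a *: x)].

Definition linear_on (A : pzRingType) (V W : lmodType A) (K : set V)
    (g : V -> W) : Prop :=
  (forall x y, K x -> K y -> g (x + y) = g x + g y) /\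
  (forall a x, K x -> g (a *: x) = a *: g x).

(** By the dual basis lemma these are the finitely generated projective
    submodules. The coordinates [s] are plain functions on the ambient module
    that need be linear on [K] only, so that no type has to be built for [K]. *)
Definition has_dual_basis (A : pzRingType) (V : lmodType A) (K : set V) : Prop :=
  exists (I : finType) (b : I -> V) (s : I -> V -> A^o),
    [/\ forall i, K (b i), forall i, linear_on K (s i) &
        forall x, K x -> \sum_i (s i x : A) *: b i = x].

Lemma scale_regularE (A : pzRingType) (a : A) (x : A^o) : a *: x = a * x :> A.
Proof. by []. Qed.

Section Submodules.
Variables (A : pzRingType) (V W : lmodType A).
Implicit Types (K : set V).

Lemma submodB K : is_submod K -> forall x y, K x -> K y -> K (x - y).
Proof. by case=> K0 KD KZ x y Kx Ky; apply: KD => //; rewrite -scaleN1r; apply: KZ. Qed.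

Lemma submod_sum K (I : Type) (r : seq I) (F : I -> V) :
  is_submod K -> (forall i, K (F i)) -> K (\sum_(i <- r) F i).
Proof. by move=> [K0 KD KZ] KF; elim/big_rec: _ => // i x _ Kx; apply: KD. Qed.

Lemma linear_on0 K (g : V -> W) : is_submod K -> linear_on K g -> g 0 = 0.
Proof. by move=> [K0 _ _] [_ gZ]; rewrite -(scale0r 0) gZ // scale0r. Qed.

Lemma linear_onB K (g : V -> W) : is_submod K -> linear_on K g ->
  forall x y, K x -> K y -> g (x - y) = g x - g y.
Proof.
move=> [K0 KD KZ] [gD gZ] x y Kx Ky.
rewrite -scaleN1r gD ?gZ ?scaleN1r // -scaleN1r; exact: KZ.
Qed.

Lemma linear_on_sum K (g : V -> W) (I : Type) (r : seq I) (F : I -> V) :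
  is_submod K -> linear_on K g -> (forall i, K (F i)) ->
  g (\sum_(i <- r) F i) = \sum_(i <- r) g (F i).
Proof.
move=> sK gL KF; elim: r => [|i r IHr]; first by rewrite !big_nil (linear_on0 sK gL).
rewrite !big_cons -IHr; apply: (proj1 gL) => //; exact: submod_sum.
Qed.

Lemma submodP K : is_submod K ->
  exists S : submodClosed V, forall x, x \in S <-> K x.
Proof.
move=> sK; pose P : {pred V} := fun x => `[< K x >].
have P0 : addr_closed P /\ scaler_closed P.
  case: sK => K0 KD KZ; split; first split.
  - exact/asboolP.
  - by move=> x y /asboolP Kx /asboolP Ky; apply/asboolP/KD.
  - by move=> a x /asboolP Kx; apply/asboolP/KZ.
have Psub : submod_closed P.
  case: P0 => -[P0 PD] PZ; split=> // a x y Px Py.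
  by apply: PD => //; apply: PZ.
pose S0 := GRing.isSubmodClosed.Build A V P Psub.
pose S : submodClosed V := HB.pack P S0.
exists S => x; rewrite (_ : (x \in S) = `[< K x >]) //.
by split=> /asboolP.
Qed.

Lemma submodClosed_submod (S : submodClosed V) : is_submod [set x | x \in S].
Proof.
split=> [|x y Sx Sy|a x Sx]; rewrite /mkset.
- exact: rpred0.
- exact: rpredD.
- exact: rpredZ.
Qed.

End Submodules.

Section DualBasis.
Variables (A : pzRingType) (V W : lmodType A).

(** Most projectivity claims below reduce to this one: a retract of a finitely
    generated projective module is finitely generated projective. The inclusion
    [t] may be built by choice, as only linearity on [K'] is asked. *)
Lemma dual_basis_retract (K : set V) (K' : set W) (g : {linear V -> W})
    (t : W -> V) :
  (forall x, K x -> K' (g x)) -> (forall y, K' y -> K (t y)) ->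
  linear_on K' t -> (forall y, K' y -> g (t y) = y) ->
  has_dual_basis K -> has_dual_basis K'.
Proof.
move=> gK tK [tD tZ] gtK [I [b [s [bK sL sK]]]].
exists I, (fun i => g (b i)), (fun i y => s i (t y)); split=> [i|i|y K'y].
- exact: gK.
- by split=> [x y Kx Ky|a x Kx];
    rewrite (tD, tZ) // ((sL i).1, (sL i).2) //; apply: tK.
- rewrite -[RHS]gtK // -[in RHS](sK (t y)); last exact: tK.
  by rewrite linear_sum; apply: eq_bigr => i _; rewrite linearZ.
Qed.

Lemma dual_basis_prod (K : set V) (L : set W) :
  K 0 -> L 0 -> has_dual_basis K -> has_dual_basis L ->
  has_dual_basis [set z : V * W | K z.1 /\ L z.2].
Proof.
move=> K0 L0 [I [b [s [bK sL sK]]]] [J [c [t [cL tL tK]]]].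
exists (I + J)%type,
  (fun k => match k with inl i => (b i, 0) | inr j => (0, c j) end),
  (fun k z => match k with inl i => s i z.1 | inr j => t j z.2 end).
split=> [[i|j]|[i|j]|[x y] /= [Kx Ly]].
- by split; [apply: bK|].
- by split; [|apply: cL].
- by split=> [[x ?] [y ?] [Kx _] [Ky _]|a [x ?] [Kx _]] /=;
    [apply: (sL i).1|apply: (sL i).2].
- by split=> [[? x] [? y] [_ Kx] [_ Ky]|a [? x] [_ Kx]] /=;
    [apply: (tL j).1|apply: (tL j).2].
- rewrite [LHS]surjective_pairing; congr (_, _).
    rewrite (raddf_sum fst) big_sumType /= [X in _ + X]big1 ?addr0 ?sK // => j _.
    exact: scaler0.
  rewrite (raddf_sum snd) big_sumType /= big1 ?add0r ?tK // => i _.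
  exact: scaler0.
Qed.

End DualBasis.

Lemma dual_basis_ffun (A : pzRingType) (V : lmodType A) (J : finType)
    (K : set V) :
  K 0 -> has_dual_basis K ->
  has_dual_basis [set z : {ffun J -> V} | forall j, K (z j)].
Proof.
move=> K0 [I [b [s [bK sL sK]]]].
exists (J * I)%type, (fun k => [ffun j => if j == k.1 then b k.2 else 0]),
  (fun k (z : {ffun J -> V}) => s k.2 (z k.1)).
split=> [[j i] j'|[j i]|z Kz] /=.
- by rewrite ffunE; case: ifP.
- by split=> [x y Kx Ky|a x Kx]; rewrite ffunE;
    [apply: (sL i).1|apply: (sL i).2].
- rewrite -(pair_bigA _ (fun j i => (s i (z j) : A) *: [ffun j0 => if j0 == j then b i else 0])) /=.
  apply/ffunP => j; rewrite sum_ffunE (bigD1 j) //= [X in _ + X]big1.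
    rewrite addr0 sum_ffunE -[in RHS](sK (z j)) //.
    by apply: eq_bigr => i _; rewrite !ffunE eqxx.
  move=> k kj; rewrite sum_ffunE big1 // => i _.
  by rewrite !ffunE eq_sym (negbTE kj) scaler0.
Qed.

(** For [e] idempotent, the set is the left ideal [A e]. *)
Lemma dual_basis_cyclic (A : pzRingType) (e : A) : e * e = e ->
  has_dual_basis ([set x | x * e = x] : set A^o).
Proof.
move=> ee; exists unit, (fun=> e : A^o), (fun=> id); split=> //.
by move=> x xe; rewrite big_const card_unit /= addr0.
Qed.

Lemma dual_basis_projective (A : pzRingType) (V : lmodType A)
    (S : submodClosed V) :
  has_dual_basis [set x | x \in S] -> projective_module (submodule S).
Proof.
move=> [I [b [s [bK sL sK]]]] M N p f p_surj.
pose B i : submodule S := exist _ (b i) (bK i).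
have /choice[m mP] : forall i, exists m, p m = f (B i) by move=> i; apply: p_surj.
pose g (x : submodule S) : M := \sum_i (s i (val x) : A) *: m i.
have gL : linear g.
  move=> a x y; rewrite /g scaler_sumr -big_split; apply: eq_bigr => i _ /=.
  rewrite (sL i).1 ?(sL i).2 ?scalerA ?scalerDl //=; try exact: valP.
  by apply: rpredZ; apply: valP.
pose h : {linear submodule S -> M} :=
  HB.pack g (GRing.isLinear.Build _ _ _ _ g gL).
exists h => x; rewrite /= /g linear_sum.
under eq_bigr do rewrite linearZ mP -linearZ.
rewrite -linear_sum; congr (f _); apply: val_inj.
rewrite -[RHS](sK (val x)); last exact: valP.
by rewrite raddf_sum; apply: eq_bigr.
Qed.

(** * Rings over which kernels of maps of free modules are projective *)

Definition matrix_kernel (A : pzRingType) (I J : finType) (M : I -> J -> A) :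
    set {ffun I -> A^o} :=
  [set x : {ffun I -> A^o} | forall j, \sum_i (x i : A) * M i j = 0].

Lemma matrix_kernel_submod (A : pzRingType) (I J : finType) (M : I -> J -> A) :
  is_submod (matrix_kernel M).
Proof.
split=> [j|x y Mx My j|a x Mx j].
- by rewrite big1 // => i _; rewrite ffunE mul0r.
- rewrite (eq_bigr (fun i => x i * M i j + y i * M i j)) => [|i _].
    by rewrite big_split /= Mx My addr0.
  by rewrite ffunE mulrDl.
- rewrite (eq_bigr (fun i => a * (x i * M i j))) => [|i _].
    by rewrite -mulr_sumr Mx mulr0.
  by rewrite ffunE scale_regularE mulrA.
Qed.

(** For a left noetherian ring this says that the left global dimension is at
    most two. *)
Definition kernels_projective (A : pzRingType) : Prop :=
  forall (I J : finType) (M : I -> J -> A), has_dual_basis (matrix_kernel M).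

(** The kernel on [K] is a retract of the kernel of the matrix of the composite
    of [g] with the free cover of [K] given by a dual basis. *)
Lemma dual_basis_kernel (A : pzRingType) (V : lmodType A) (J : finType)
    (K : set V) (g : J -> V -> A^o) :
  kernels_projective A -> is_submod K -> has_dual_basis K ->
  (forall j, linear_on K (g j)) ->
  has_dual_basis [set x | K x /\ forall j, g j x = 0].
Proof.
move=> kpA sK [I [b [s [bK sL bsK]]]] gL.
pose beta (c : {ffun I -> A^o}) : V := \sum_i (c i : A) *: b i.
have betaL : linear beta.
  move=> a x y; rewrite /beta scaler_sumr -big_split; apply: eq_bigr => i _ /=.
  by rewrite !ffunE scalerDl -scalerA.
pose h : {linear {ffun I -> A^o} -> V} :=
  HB.pack beta (GRing.isLinear.Build _ _ _ _ beta betaL).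
have Kbeta c : K (h c).
  by apply: submod_sum => // i; case: sK => _ _ KZ; apply: KZ.
have gbeta c j : g j (h c) = \sum_i (c i : A) * g j (b i).
  rewrite /h /= /beta (linear_on_sum _ sK (gL j)); last first.
    by move=> i; case: sK => _ _ KZ; apply: KZ.
  by apply: eq_bigr => i _; rewrite (gL j).2.
have := kpA I J (fun i j => g j (b i)).
apply: (@dual_basis_retract _ _ _ _ _ h (fun x => [ffun i => s i x])) => /=.
- by move=> c Mc; split=> [|j]; [apply: Kbeta|rewrite gbeta].
- move=> x [Kx gx] j; rewrite -[RHS](gx j) -[in RHS](bsK _ Kx).
  have -> : \sum_i (s i x : A) *: b i = h [ffun i => s i x].
    by apply: eq_bigr => i _; rewrite ffunE.
  by rewrite gbeta; apply: eq_bigr => i _; rewrite ffunE.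
- split=> [x y [Kx _] [Ky _]|a x [Kx _]]; apply/ffunP => i; rewrite !ffunE.
    exact: (sL i).1.
  exact: (sL i).2.
- by move=> x [Kx _]; rewrite -[RHS](bsK _ Kx) /beta; apply: eq_bigr => i _; rewrite ffunE.
Qed.

(** * Artinian modules *)

Definition artinian (A : pzRingType) (V : lmodType A) : Prop :=
  forall L : nat -> set V,
    (forall n, is_submod (L n)) -> (forall n, L n.+1 `<=` L n) ->
    exists N, forall n, (N <= n)%N -> L N `<=` L n.

Section Artinian.
Variables (A : pzRingType) (V : lmodType A).
Hypothesis artV : artinian V.

Lemma artinian_min (Q : set (set V)) :
  (forall K, Q K -> is_submod K) -> (exists K, Q K) ->
  exists2 K, Q K & forall K', Q K' -> K' `<=` K -> K `<=` K'.
Proof.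
move=> Qsub [K0 QK0]; apply: contrapT => noMin.
have /choice[f fP] : forall K, exists K', Q K -> [/\ Q K', K' `<=` K & ~ K `<=` K'].
  move=> K; have [QK|nQK] := pselect (Q K); last by exists K.
  apply: contrapT => noK'; apply: noMin; exists K => // K' QK' K'K.
  by apply: contrapT => nKK'; apply: noK'; exists K'.
have Qf n : Q (iter n f K0) by elim: n => //= n /fP[].
have [//|n|N /(_ N.+1 (leqnSn N))] := artV (L := fun n => iter n f K0).
- by move=> n; apply: Qsub.
- by have [] := fP _ (Qf n).
- by have [] := fP _ (Qf N).
Qed.

(** Fitting: the images of the iterates of [g] stabilise, and injectivity of
    the iterates then gives surjectivity of [g]. *)
Lemma artinian_inj_surj (K : set V) (g : V -> V) :
  is_submod K -> linear_on K g -> (forall x, K x -> K (g x)) ->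
  (forall x, K x -> g x = 0 -> x = 0) ->
  forall y, K y -> exists2 x, K x & g x = y.
Proof.
move=> sK gL gK g_inj y Ky.
have K_iter n x : K x -> K (iter n g x) by move=> Kx; elim: n => //= n /gK.
have L_iter n : linear_on K (iter n g).
  elim: n => [|n [IHD IHZ]]; first by split.
  split=> [x x' Kx Kx'|a x Kx] /=.
    by rewrite IHD // (gL.1) //; apply: K_iter.
  by rewrite IHZ // (gL.2) //; apply: K_iter.
have iter_inj n x : K x -> iter n g x = 0 -> x = 0.
  elim: n => // n IHn Kx /= /(g_inj _ (K_iter n x Kx)); exact: IHn.
case: (sK) => K0 KD KZ.
have [n|n|N /(_ N.+1 (leqnSn N))] :=
  artV (L := fun n => [set z | exists2 x, K x & z = iter n g x]).
- split.
  + by exists 0 => //; rewrite (linear_on0 sK).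
  + move=> _ _ [x Kx ->] [x' Kx' ->]; exists (x + x'); first exact: KD.
    by rewrite (L_iter n).1.
  + move=> a _ [x Kx ->]; exists (a *: x); first exact: KZ.
    by rewrite (L_iter n).2.
- by move=> _ [x Kx ->]; exists (g x); [apply: gK|rewrite iterSr].
- move=> /(_ (iter N g y)) []; first by exists y.
  move=> x Kx yx; exists x => //; apply/eqP; rewrite -subr_eq0; apply/eqP.
  apply: (@iter_inj N); first by apply: submodB => //; apply: gK.
  by rewrite (linear_onB sK) //; [rewrite yx -iterSr subrr|apply: gK].
Qed.

End Artinian.

(** * The heredity ideal generated by a minimal projective left ideal *)

(** Take [P] minimal among the nonzero finitely generated projective left
    ideals. A nonzero endomorphism of [P] has a projective kernel strictly
    inside [P], so it is injective, hence bijective. One of the summands of the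
    identity given by a dual basis is such an endomorphism, which makes [P]
    isomorphic to [A e]; the minimality of [P] then passes to [A e]. *)
Lemma minimal_projective_idempotent (A : pzRingType) :
  artinian A^o -> kernels_projective A -> (1 : A) <> 0 ->
  exists e : A, [/\ e * e = e, e <> 0 &
    forall K : set A^o, is_submod K -> has_dual_basis K ->
      (forall x, K x -> x * e = x) -> (exists2 x, K x & x <> 0) -> K e].
Proof.
move=> artA kpA one_nz.
have [] := artinian_min artA
  (Q := [set K | [/\ is_submod K, has_dual_basis K & exists2 x, K x & x <> 0]]).
- by move=> K [].
- exists [set x | x * 1 = x]; split.
  + by split=> [|x y _ _|a x _] /=; rewrite mulr1.
  + by apply: dual_basis_cyclic; rewrite mulr1.
  + by exists 1 => //=; rewrite mulr1.
move=> P [sP [I [b [s [bP sL sP_id]]]] [p0 Pp0 p0_nz]] Pmin.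
case: (sP) => P0 PD PZ.
pose theta i (x : A^o) : A^o := (s i x : A) *: b i.
have thetaL i : linear_on P (theta i).
  split=> [x y Px Py|a x Px]; rewrite /theta.
    by rewrite (sL i).1 // scalerDl.
  by rewrite (sL i).2 // scalerA.
have [i [p1 Pp1 p1_nz]] : exists i, exists2 x, P x & theta i x <> 0.
  apply: contrapT => theta0; apply: p0_nz; rewrite -(sP_id _ Pp0) big1 // => i _.
  by apply: contrapT => nz; apply: theta0; exists i; exists p0.
have theta_inj x : P x -> theta i x = 0 -> x = 0.
  move=> Px x0; apply: contrapT => x_nz.
  have [||_ /(_ tt)//] := Pmin [set x | P x /\ forall j : unit, theta i x = 0] _ _ p1 Pp1.
  - split.
    + split=> [|y z [Py y0] [Pz z0]|a y [Py y0]] /=.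
      * by split=> // _; rewrite (linear_on0 sP).
      * by split=> [|_]; [apply: PD|rewrite (thetaL i).1 // y0 // z0 // addr0].
      * by split=> [|_]; [apply: PZ|rewrite (thetaL i).2 // y0 // scaler0].
    + by apply: (@dual_basis_kernel _ _ unit P (fun=> theta i)) => //; exists I, b, s.
    + by exists x.
  - by move=> y [].
have [w Pw wb] : exists2 w, P w & theta i w = b i.
  apply: (artinian_inj_surj artA sP (thetaL i)) => // x Px.
  exact: PZ.
(* The endomorphism x |-> s(x) b is bijective on P, so s followed by scaling
   the preimage w of b is the identity: P = A w. *)
have swP x : P x -> (s i x : A) *: w = x.
  move=> Px; apply/eqP; rewrite -subr_eq0; apply/eqP.
  have Psw : P ((s i x : A) *: w) by apply: PZ.
  apply: theta_inj; first exact: submodB.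
  by rewrite (linear_onB sP) // (thetaL i).2 // wb subrr.
pose e : A := s i w.
have ew : e * w = w by apply: swP.
exists e; split.
- by rewrite {2}/e -[e * s i w]/(e *: s i w) -(sL i).2 // [e *: w]ew.
- by move=> e0; apply: p0_nz; rewrite -(swP _ Pp0) -ew e0 mul0r scaler0.
move=> K sK dbK Ke [k0 Kk0 k0_nz].
case: (sK) => K0 KD KZ.
have sw x : s i (x *: w) = x * e :> A by rewrite (sL i).2.
pose K' : set A^o := [set y | exists2 x, K x & y = (x : A) *: w].
have [|y [x Kx ->]|x Kx wx] := Pmin K' _ _ w Pw; last 1 first.
- have -> : e = x by rewrite /e wx sw Ke.
  exact: Kx.
- split.
  + split.
    * by exists 0 => //; rewrite scale0r.
    * by move=> _ _ [x Kx ->] [y Ky ->]; exists (x + y); [apply: KD|rewrite scalerDl].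
    * by move=> a _ [x Kx ->]; exists (a *: x); [apply: KZ|rewrite scalerA].
  + pose mw (x : A^o) : A^o := (x : A) *: w.
    have mwL : linear mw by move=> a x y; rewrite /mw scalerDl -scalerA.
    pose mw_lin : {linear A^o -> A^o} :=
      HB.pack mw (GRing.isLinear.Build _ _ _ _ mw mwL).
    apply: (@dual_basis_retract _ _ _ K K' mw_lin (s i)) => //=.
    * by move=> x Kx; exists x.
    * by move=> _ [x Kx ->]; rewrite sw Ke.
    * by split=> [_ _ [x Kx ->] [y Ky ->]|a _ [x Kx ->]];
        [apply: (sL i).1|apply: (sL i).2]; apply: PZ.
    * by move=> _ [x Kx ->]; rewrite /mw sw Ke.
  + exists ((k0 : A) *: w); first by exists k0.
    by move=> kw0; apply: k0_nz; rewrite -(Ke _ Kk0) -sw kw0 (linear_on0 sP).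
- exact: PZ.
Qed.

(** Artin algebras have this property, and so do their quotients; it makes
    every [A e A] a finite sum of left ideals [A e y]. *)
Definition center_finite (A : pzRingType) : Prop :=
  exists n (g : 'I_n -> A), forall y : A, exists c : 'I_n -> A,
    (forall i x, c i * x = x * c i) /\ y = \sum_i c i * g i.

Definition idem_ideal (A : pzRingType) (e : A) : set A^o :=
  [set x | exists n (a b : 'I_n -> A), x = \sum_i a i * e * b i].

Section MinimalIdempotent.
Variables (A : pzRingType) (e : A).
Hypotheses (artA : artinian A^o) (kpA : kernels_projective A).
Hypotheses (ee : e * e = e) (e_nz : e <> 0).
Hypothesis e_min : forall K : set A^o, is_submod K -> has_dual_basis K ->
  (forall x, K x -> x * e = x) -> (exists2 x, K x & x <> 0) -> K e.

Let Ae : set A^o := [set x | x * e = x].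

Let sAe : is_submod Ae.
Proof.
split=> [|x y xe ye|a x xe]; rewrite /Ae /=; first exact: mul0r.
  by rewrite mulrDl xe ye.
by rewrite scale_regularE -mulrA xe.
Qed.

Let rmul_linear (K : set A^o) (f : A) : linear_on K (fun x : A^o => (x * f : A^o)).
Proof. by split=> [x y _ _|a x _]; rewrite ?mulrDl // scale_regularE -mulrA. Qed.

(** The kernel of [x |-> x f] on [A e] is projective and omits [e], so it is
    zero. *)
Lemma minimal_idem_inj f x : e * f = f -> f <> 0 -> x * e = x -> x * f = 0 -> x = 0.
Proof.
move=> ef f_nz xe xf; apply: contrapT => x_nz; apply: f_nz.
have [||y []//||ee0 /(_ tt)] := e_min (K := [set y | Ae y /\ forall _ : unit, y * f = 0]).
- split=> [|y z [ye y0] [ze z0]|a y [ye y0]].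
  + by case: sAe => Ae0 _ _; split=> // _; rewrite mul0r.
  + by case: sAe => _ AeD _; split=> [|_]; [apply: AeD|rewrite mulrDl y0 // z0 // addr0].
  + by case: sAe => _ _ AeZ; split=> [|_]; [apply: AeZ|rewrite scale_regularE -mulrA y0 // mulr0].
- exact: (dual_basis_kernel kpA sAe (dual_basis_cyclic ee)
            (fun _ : unit => rmul_linear Ae f)).
- by exists x.
- by rewrite ef.
Qed.

Lemma minimal_idem_division f : e * f = f -> f * e = f -> f <> 0 -> exists b, b * f = e.
Proof.
move=> ef fe f_nz.
have [x||//|x xe <-] := artinian_inj_surj artA sAe (rmul_linear Ae f) _ _ (y := e).
- by move=> _; rewrite /Ae /= -mulrA fe.
- by move=> x xe; apply: minimal_idem_inj.
- by exists x.
Qed.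

(** A nonzero product would be invertible in [e A e]. Then [n] would lie outside
    the left ideal of the [m] for which [m a e] does not generate [A e], and
    that left ideal is maximal because [A e] is local. *)
Lemma minimal_idem_rad b n a : rad n -> e * b * n * a * e = 0.
Proof.
move=> rad_n; apply: contrapT => nz.
have [c cE] : exists c, c * (e * b * n * a * e) = e.
  by apply: minimal_idem_division => //; rewrite ?mulrA ?ee // -mulrA ee.
pose M : set A^o := [set m : A | ~ exists d, d * m * a * e = e].
have [S SM] : exists S : submodClosed A^o, forall x, x \in S <-> M x.
  apply: submodP; split=> [[d]|m m' Mm Mm' [d dE]|x m Mm [d dE]].
  - by rewrite mulr0 !mul0r => /esym.
  - have zero k : M k -> e * d * k * a * e = 0.
      move=> Mk; apply: contrapT => nz'; apply: Mk.
      have [||//|c' c'E] := @minimal_idem_division (e * d * k * a * e).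
      + by rewrite !mulrA ee.
      + by rewrite -mulrA ee.
      + by exists (c' * (e * d)); rewrite -[RHS]c'E !mulrA.
    by apply: e_nz; rewrite -{1}ee -{2}dE mulrDr !mulrDl mulrDr !mulrA !zero // addr0.
  - by apply: Mm; exists (d * x); rewrite -[RHS]dE scale_regularE !mulrA.
have maxS : maximal_left_ideal S.
  split=> [|L SL L1 m Lm].
    apply/negP => /SM; apply; exists (c * (e * b * n)).
    by rewrite mulr1 -[RHS]cE !mulrA.
  apply/SM => -[d dE]; move/negP: L1; apply.
  rewrite -[1](subrK (a * e * d * m)); apply: rpredD; last exact: (rpredZ (a * e * d)).
  apply/SL/SM => -[d' d'E]; apply: e_nz; rewrite -d'E.
  rewrite mulrBr mulr1 !mulrBl.
  have -> : d' * (a * e * d * m) * a * e = d' * (a * e * (d * m * a * e)).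
    by rewrite !mulrA.
  by rewrite dE -(mulrA a) ee mulrA subrr.
have /SM := rad_n _ maxS; apply; exists (c * (e * b)).
by rewrite -[RHS]cE !mulrA.
Qed.

(** The elements [x] of [A e] with [x f] in [I] form a projective submodule of
    [A e], being isomorphic to the kernel of the map [(x, y) |-> x f - y] from
    the product of [A e] and [I] to [A]. By minimality they are all of [A e],
    and then [A f] lies in [I], or zero, and then [I + A f] is isomorphic to
    that product. *)
Lemma dual_basis_add_cyclic (I : set A^o) f :
  is_submod I -> has_dual_basis I -> e * f = f ->
  has_dual_basis [set z : A^o | exists2 x, Ae x & exists2 y, I y & z = x * f + y].
Proof.
move=> sI dbI ef; case: (sI) => I0 ID IZ; case: (sAe) => Ae0 AeD AeZ.
have dbAe : has_dual_basis Ae by exact: dual_basis_cyclic.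
have sAeI : is_submod [set z : A^o * A^o | Ae z.1 /\ I z.2].
  split=> [//|x y [? ?] [? ?]|a x [? ?]]; split=> /=.
  - exact: AeD.
  - exact: ID.
  - exact: AeZ.
  - exact: IZ.
have dbAeI := dual_basis_prod Ae0 I0 dbAe dbI.
pose K : set A^o := [set x | Ae x /\ I (x * f)].
have sK : is_submod K.
  split=> [|x y [? ?] [? ?]|a x [? ?]]; split=> //.
  - by rewrite mul0r.
  - exact: AeD.
  - by rewrite mulrDl; apply: ID.
  - exact: AeZ.
  - by rewrite scale_regularE -mulrA; apply: IZ.
have dbK : has_dual_basis K.
  pose g (z : A^o * A^o) : A^o := z.1 * f - z.2.
  have gL : linear_on [set z : A^o * A^o | Ae z.1 /\ I z.2] g.
    split=> [x y _ _|a x _]; rewrite /g /=.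
      by rewrite mulrDl opprD addrACA.
    by rewrite !scale_regularE -mulrA mulrBr.
  apply: (@dual_basis_retract _ _ _ _ K fst (fun x => (x, x * f) : A^o * A^o))
           (dual_basis_kernel kpA sAeI dbAeI (fun _ : unit => gL)).
  - move=> [x y] /= [[xe Iy] /(_ tt) /eqP]; rewrite /g /= subr_eq0 => /eqP xf.
    by split=> //; rewrite xf.
  - by move=> x [xe Ixf]; split=> //= _; rewrite /g /= subrr.
  - split=> [x y _ _|a x _]; first by rewrite mulrDl.
    by rewrite scale_regularE -mulrA.
  - by [].
have [[x Kx x_nz]|K0] := pselect (exists2 x, K x & x <> 0).
  have [_] : K e by apply: e_min => //; [move=> ? []|exists x].
  rewrite ef => If.
  rewrite (_ : [set z | _] = I) //; apply/seteqP; split=> [_ [y _ [z Iz ->]]|y Iy].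
    by apply: ID => //; apply: (IZ y).
  by exists 0; [|exists y => //; rewrite mul0r add0r].
have uniq x x' y y' : Ae x -> Ae x' -> I y -> I y' ->
    x * f + y = x' * f + y' -> x = x' /\ y = y'.
  move=> xe x'e Iy Iy' eq_xy.
  have xx' : x = x'.
    apply/eqP; rewrite -subr_eq0; apply/eqP; apply: contrapT => nz; apply: K0.
    exists (x - x') => //; split; first exact: submodB.
    rewrite mulrBl (_ : _ - _ = y' - y); first exact: submodB.
    by apply/eqP; rewrite subr_eq addrAC eq_sym subr_eq eq_sym [y' + _]addrC; apply/eqP.
  by split=> //; move: eq_xy; rewrite xx' => /addrI.
have /choice[t tP] : forall z : A^o, exists p : A^o * A^o,
    (exists2 x, Ae x & exists2 y, I y & z = x * f + y) ->
    [/\ Ae p.1, I p.2 & z = p.1 * f + p.2].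
  move=> z.
  have [[x xe [y Iy zE]]|nz] := pselect (exists2 x, Ae x & exists2 y, I y & z = x * f + y).
    by exists (x, y).
  by exists 0.
pose add_f (p : A^o * A^o) : A^o := p.1 * f + p.2.
have add_fL : linear add_f.
  by move=> a x y; rewrite /add_f /= mulrDl !scale_regularE -mulrA mulrDr addrACA.
pose add_f_lin : {linear (A^o * A^o)%type -> A^o} :=
  HB.pack add_f (GRing.isLinear.Build _ _ _ _ add_f add_fL).
apply: (@dual_basis_retract _ _ _ _ _ add_f_lin t) dbAeI => /=.
- by move=> [x y] [/= xe Iy]; exists x => //; exists y.
- by move=> z /tP[].
- split=> [z z' Lz Lz'|a z Lz].
    have [xe Iy zE] := tP _ Lz; have [xe' Iy' zE'] := tP _ Lz'.
    have [|xe'' Iy'' zE''] := tP (z + z').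
      exists ((t z).1 + (t z').1); first exact: AeD.
      by exists ((t z).2 + (t z').2); [apply: ID|rewrite {1}zE {1}zE' mulrDl addrACA].
    have [|||||e1 e2] := uniq (t (z + z')).1 ((t z).1 + (t z').1)
                              (t (z + z')).2 ((t z).2 + (t z').2) => //.
    + exact: AeD.
    + exact: ID.
    + by rewrite -zE'' {1}zE {1}zE' mulrDl addrACA.
    by rewrite [LHS]surjective_pairing e1 e2.
  have [xe Iy zE] := tP _ Lz.
  have [|xe'' Iy'' zE''] := tP (a *: z).
    exists (a *: (t z).1); first exact: AeZ.
    by exists (a *: (t z).2); [apply: IZ|rewrite {1}zE !scale_regularE mulrDr mulrA].
  have [|||||e1 e2] := uniq (t (a *: z)).1 (a *: (t z).1)
                            (t (a *: z)).2 (a *: (t z).2) => //.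
  + exact: AeZ.
  + exact: IZ.
  + by rewrite -zE'' {1}zE !scale_regularE mulrDr mulrA.
  by rewrite [LHS]surjective_pairing e1 e2.
- by move=> z /tP[].
Qed.

End MinimalIdempotent.

Section IdempotentIdeal.
Variables (A : pzRingType) (e : A).
Hypothesis ee : e * e = e.

Lemma idem_ideal_gen (x y : A) : idem_ideal e (x * e * y : A).
Proof. by exists 1%N, (fun=> x), (fun=> y); rewrite big_ord1. Qed.

Lemma idem_ideal_min (K : set A^o) : is_submod K -> (forall y, K (e * y)) ->
  idem_ideal e `<=` K.
Proof.
move=> sK Ke _ [n [a [b ->]]]; apply: (submod_sum _ sK) => i.
by case: sK => _ _ KZ; rewrite -mulrA; apply: (KZ (a i)).
Qed.

Lemma idem_ideal_submod : is_submod (idem_ideal e).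
Proof.
split=> [|_ _ [n [a [b ->]]] [m [c [d ->]]]|x _ [n [a [b ->]]]].
- by exists 0%N, (fun=> 0), (fun=> 0); rewrite big_ord0.
- exists (n + m)%N, (fun i => match split i with inl j => a j | inr k => c k end),
    (fun i => match split i with inl j => b j | inr k => d k end).
  rewrite big_split_ord /=; congr (_ + _); apply: eq_bigr => i _.
    by rewrite (unsplitK (inl i)).
  by rewrite (unsplitK (inr i)).
- exists n, (fun i => x * a i), b; rewrite scale_regularE mulr_sumr.
  by apply: eq_bigr => i _; rewrite !mulrA.
Qed.

Lemma idem_ideal_two_sided (x a : A) : idem_ideal e x -> idem_ideal e (x * a : A).
Proof.
move=> [n [b [c ->]]]; rewrite mulr_suml.
apply: (submod_sum _ idem_ideal_submod) => i.
by rewrite -mulrA; exact: (idem_ideal_gen (b i) (c i * a)).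
Qed.

Lemma idem_ideal_idempotent (x : A) : idem_ideal e x ->
  exists n (a b : 'I_n -> A),
    (forall i, idem_ideal e (a i) /\ idem_ideal e (b i)) /\ x = \sum_i a i * b i.
Proof.
move=> [n [a [b ->]]]; exists n, (fun i => a i * e), (fun i => e * b i).
split=> [i|]; last by apply: eq_bigr => i _; rewrite mulrA -[_ * e * e]mulrA ee.
split; first by rewrite -[_ * e]mulr1; apply: idem_ideal_gen.
by rewrite -[e * _]mul1r mulrA; apply: idem_ideal_gen.
Qed.

End IdempotentIdeal.

(** The sum of the left ideals [A e y], for [y] in a finite generating family
    over the centre, is [A e A]. *)
Lemma idem_ideal_dual_basis (A : pzRingType) (e : A) :
  artinian A^o -> kernels_projective A -> center_finite A -> e * e = e ->
  (forall K : set A^o, is_submod K -> has_dual_basis K ->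
      (forall x, K x -> x * e = x) -> (exists2 x, K x & x <> 0) -> K e) ->
  has_dual_basis (idem_ideal e).
Proof.
move=> artA kpA [n [g g_gen]] ee e_min.
have sJ := idem_ideal_submod e.
have [I [sI dbI IJ Ig]] : exists I : set A^o, [/\ is_submod I, has_dual_basis I,
    I `<=` idem_ideal e & forall a, a \in codom g -> I (e * a)].
  elim: (codom g) => [|a r' [I [sI dbI IJ Ir']]].
    (* The zero ideal, as the cyclic left ideal of the idempotent 0. *)
    exists [set x | x * 0 = x]; split=> //.
    - split=> [|x y|a x] /=; rewrite !mulr0 // => <-; last by rewrite scaler0.
      by move=> <-; rewrite addr0.
    - by apply: dual_basis_cyclic; rewrite mulr0.
    - by move=> x /=; rewrite mulr0 => <-; case: sJ.
  exists [set z : A^o | exists2 x, x * e = x & exists2 y, I y & z = x * (e * a) + y].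
  case: (sI) => I0 ID IZ; split.
  - split.
    + by exists 0; [rewrite mul0r|exists 0; rewrite ?mul0r ?addr0].
    + move=> _ _ [x xe [y Iy ->]] [x' xe' [y' Iy' ->]].
      exists (x + x'); first by rewrite mulrDl xe xe'.
      by exists (y + y'); [apply: ID|rewrite mulrDl addrACA].
    + move=> c _ [x xe [y Iy ->]]; exists (c * x); first by rewrite -mulrA xe.
      by exists (c *: y : A^o); [apply: IZ|rewrite !scale_regularE mulrDr !mulrA].
  - by apply: (dual_basis_add_cyclic kpA ee e_min sI dbI); rewrite mulrA ee.
  - move=> _ [x xe [y Iy ->]]; case: sJ => _ JD _; apply: JD; last exact: IJ.
    by rewrite mulrA; apply: idem_ideal_gen.
  - move=> y; rewrite inE => /predU1P[->|/Ir' Iy].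
      by exists e => //; exists 0 => //; rewrite mulrA ee addr0.
    by exists 0; rewrite ?mul0r //; exists (e * y) => //; rewrite add0r.
rewrite (_ : idem_ideal e = I) //; apply/seteqP; split=> //.
apply: idem_ideal_min => // y; have [c [cZ ->]] := g_gen y.
rewrite mulr_sumr; apply: (submod_sum _ sI) => i.
by rewrite mulrA -cZ -mulrA; case: sI => _ _ IZ; apply: (IZ (c i)); apply/Ig/codom_f.
Qed.

Lemma heredity_ideal_exists (A : pzRingType) :
  artinian A^o -> kernels_projective A -> center_finite A -> (1 : A) <> 0 ->
  exists (e : A) (J : submodClosed A^o),
    [/\ e * e = e, e <> 0, forall x, x \in J <-> idem_ideal e x,
        has_dual_basis (idem_ideal e) & heredity_ideal J].
Proof.
move=> artA kpA cfA one_nz.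
have [e [ee e_nz e_min]] := minimal_projective_idempotent artA kpA one_nz.
have [J JP] := submodP (idem_ideal_submod e).
have dbJ := idem_ideal_dual_basis artA kpA cfA ee e_min.
exists e, J; split=> //; split.
- by move=> x a /JP Jx; apply/JP/idem_ideal_two_sided.
- move=> x /JP /(idem_ideal_idempotent ee) [n [a [b [Jab ->]]]].
  by exists n, a, b; split=> // i; have [/JP Ja /JP Jb] := Jab i.
- move=> x n y /JP[k [a [b ->]]] rad_n /JP[l [c [d ->]]].
  rewrite !mulr_suml big1 // => i _; rewrite mulr_sumr big1 // => j _.
  have -> : a i * e * b i * n * (c j * e * d j) = a i * (e * b i * n * c j * e) * d j.
    by rewrite !mulrA.
  by rewrite (minimal_idem_rad artA kpA ee e_nz e_min) // mulr0 mul0r.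
- apply: dual_basis_projective.
  by rewrite (_ : [set x | x \in J] = idem_ideal e) //; apply/seteqP; split=> x /JP.
Qed.

(** * Passing to the quotient by the heredity ideal *)

Section Quotient.
Variables (A B : pzRingType) (pi : {rmorphism A -> B}) (J : set A^o).
Hypotheses (pi_surj : forall b, exists a, pi a = b).
Hypotheses (pi_ker : forall a, pi a = 0 <-> J a).
Hypotheses (sJ : is_submod J) (JR : forall x a : A, J x -> J (x * a)).
Hypotheses (JJ : forall x : A, J x -> exists n (a b : 'I_n -> A),
    (forall i, J (a i) /\ J (b i)) /\ x = \sum_i a i * b i).
Hypotheses (dbJ : has_dual_basis J) (kpA : kernels_projective A).

(** The kernel of a matrix over [A / J] lifts to the preimage [N] of [J^n]
    under the lifted matrix. As [J] is projective, [N] is isomorphic to the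
    kernel of a map of projectives from [A^m x J^n] to [A^n], hence projective.
    As [J] is idempotent, [J^m] equals [J N], so the original kernel [N / J^m]
    is obtained from [N] by reduction modulo [J]. *)
Lemma kernels_projective_quotient : kernels_projective B.
Proof.
move=> I K M; case: (sJ) => J0 JD JZ.
have /choice[M' M'P] : forall p : I * K, exists a, pi a = M p.1 p.2.
  by move=> p; apply: pi_surj.
pose mulM (x : {ffun I -> A^o}) : {ffun K -> A^o} :=
  [ffun k => \sum_i (x i : A) * M' (i, k)].
have mulM_D (x y : {ffun I -> A^o}) : mulM (x + y) = mulM x + mulM y.
  apply/ffunP => k; rewrite !ffunE -big_split; apply: eq_bigr => i _.
  by rewrite ffunE mulrDl.
have mulM_Z a (x : {ffun I -> A^o}) : mulM (a *: x) = a *: mulM x.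
  apply/ffunP => k; rewrite !ffunE scale_regularE mulr_sumr; apply: eq_bigr => i _.
  by rewrite ffunE mulrA.
pose N : set {ffun I -> A^o} := [set x | forall k, J (mulM x k)].
have sN : is_submod N.
  split=> [k|x y Nx Ny k|a x Nx k].
  - by rewrite -(scale0r 0) mulM_Z scale0r ffunE.
  - by rewrite mulM_D ffunE; apply: JD.
  - by rewrite mulM_Z ffunE; apply: JZ.
have JN (x : {ffun I -> A^o}) : (forall i, J (x i)) -> N x.
  move=> Jx k; rewrite ffunE; apply: (submod_sum _ sJ) => i; exact: JR.
have dbN : has_dual_basis N.
  have db1 := dual_basis_cyclic (mulr1 (1 : A)).
  (* The product of A^I and J^K; the trivial condition a * 1 = a presents A as
     the cyclic left ideal A 1, for which a dual basis is known. *)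
  pose VW := [set z : {ffun I -> A^o} * {ffun K -> A^o} |
    (forall i, z.1 i * 1 = z.1 i) /\ (forall k, J (z.2 k))].
  have sVW : is_submod VW.
    split=> [|x y [_ Jx] [_ Jy]|a x [_ Jx]]; split=> k; rewrite ?mulr1 //= ffunE //.
      exact: JD.
    exact: JZ.
  have dbVW : has_dual_basis VW.
    apply: (dual_basis_prod (K := [set x : {ffun I -> A^o} | forall i, x i * 1 = x i])
              (L := [set y : {ffun K -> A^o} | forall k, J (y k)])).
    - by move=> i; rewrite ffunE mul0r.
    - by move=> k; rewrite ffunE.
    - by apply: dual_basis_ffun db1; rewrite /= mul0r.
    - exact: dual_basis_ffun.
  pose g k (z : {ffun I -> A^o} * {ffun K -> A^o}) : A^o := mulM z.1 k - z.2 k.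
  have gL k : linear_on VW (g k).
    split=> [x y _ _|a x _]; rewrite /g /=.
      by rewrite mulM_D !ffunE opprD addrACA.
    by rewrite mulM_Z [in LHS]ffunE [in X in _ - X]ffunE -scalerBr.
  apply: (@dual_basis_retract _ _ _ _ N fst (fun x => (x, mulM x)))
    (dual_basis_kernel kpA sVW dbVW gL).
  - move=> [x y] /= [[_ Jy] gxy] k.
    by move/eqP: (gxy k); rewrite /g /= subr_eq0 => /eqP ->.
  - move=> x Nx; split=> [|k]; first by split=> // i; rewrite mulr1.
    by rewrite /g subrr.
  - by split=> [x y _ _|a x _]; rewrite ?mulM_D ?mulM_Z.
  - by [].
have [L [b [s [bN sL sN_id]]]] := dbN.
pose delta i (a : A) : {ffun I -> A^o} := [ffun i' => if i' == i then a else 0].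
have N_delta i a : J a -> N (delta i a).
  by move=> Ja; apply: JN => i'; rewrite ffunE; case: ifP.
(* J^m = J (J^m) lies in J N, which the coordinates s send to J. *)
have sJN l (x : {ffun I -> A^o}) : (forall i, J (x i)) -> J (s l x).
  move=> Jx; have -> : x = \sum_i delta i (x i).
    apply/ffunP => i; rewrite sum_ffunE (bigD1 i) //= big1 ?addr0 ?ffunE ?eqxx //.
    by move=> i' /negbTE i'i; rewrite ffunE eq_sym i'i.
  rewrite (linear_on_sum _ sN) //; last by move=> i; apply: N_delta.
  apply: (submod_sum _ sJ) => i; have [n [c [d [Jcd ->]]]] := JJ (Jx i).
  have -> : delta i (\sum_j c j * d j) = \sum_j c j *: delta i (d j).
    apply/ffunP => i'; rewrite sum_ffunE ffunE; case: ifP => i'i.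
      by apply: eq_bigr => j _; rewrite !ffunE i'i.
    by rewrite big1 // => j _; rewrite !ffunE i'i scaler0.
  have Nd j : N (c j *: delta i (d j)).
    by case: sN => _ _ NZ; apply: NZ; apply: N_delta; case: (Jcd j).
  rewrite (linear_on_sum _ sN) //; apply: (submod_sum _ sJ) => j.
  rewrite (sL l).2; last by apply: N_delta; case: (Jcd j).
  by apply: JR; case: (Jcd j).
have s_pi l (x y : {ffun I -> A^o}) : N x -> N y ->
    (forall i, pi (x i) = pi (y i)) -> pi (s l x) = pi (s l y).
  move=> Nx Ny xy; apply/eqP; rewrite -subr_eq0 -rmorphB; apply/eqP/pi_ker.
  rewrite -(linear_onB sN (sL l)) //; apply: sJN => i; apply/pi_ker.
  by rewrite !ffunE rmorphB xy subrr.
have /choice[lift liftP] : forall z : {ffun I -> B^o}, exists x : {ffun I -> A^o},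
    forall i, pi (x i) = z i.
  move=> z; have /choice[x xP] : forall i, exists a, pi a = z i by move=> i; apply: pi_surj.
  by exists [ffun i => x i] => i; rewrite ffunE.
have pi_mulM (x : {ffun I -> A^o}) k : pi (mulM x k) = \sum_i pi (x i) * M i k.
  by rewrite ffunE rmorph_sum; apply: eq_bigr => i _; rewrite rmorphM M'P.
have N_lift z : matrix_kernel M z -> N (lift z).
  move=> Mz k; apply/pi_ker; rewrite pi_mulM -[RHS](Mz k).
  by apply: eq_bigr => i _; rewrite liftP.
case: (sN) => _ ND NZ.
have [_ kerD kerZ] := matrix_kernel_submod M.
exists L, (fun l => [ffun i => pi (b l i)]), (fun l z => pi (s l (lift z))).
split=> [l k|l|z Mz].
- rewrite (eq_bigr (fun i => pi (b l i) * M i k)) => [|i _]; last by rewrite ffunE.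
  by rewrite -pi_mulM; apply/pi_ker/bN.
- split=> [z z' Mz Mz'|c z Mz].
    rewrite -rmorphD -(sL l).1; try exact: N_lift.
    apply: s_pi => [||i]; first by apply/N_lift/kerD.
      by apply: ND; apply: N_lift.
    by rewrite liftP !ffunE rmorphD !liftP.
  have [a aE] := pi_surj c; rewrite scale_regularE -aE -rmorphM.
  rewrite -[a * _]/(a *: _) -(sL l).2; last exact: N_lift.
  apply: s_pi => [||i]; first by apply/N_lift/kerZ.
    by apply: NZ; apply: N_lift.
  by rewrite liftP !ffunE rmorphM !liftP aE.
- apply/ffunP => i; rewrite sum_ffunE -liftP -[in RHS](sN_id (lift z)); last exact: N_lift.
  rewrite sum_ffunE rmorph_sum; apply: eq_bigr => l _.
  by rewrite !ffunE scale_regularE rmorphM.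
Qed.

Lemma artinian_quotient : artinian A^o -> artinian B^o.
Proof.
move=> artA L sL Ldec.
have [n|n x /=|N NP] := artA (fun n => [set x : A^o | L n (pi x)]).
- case: (sL n) => L0 LD LZ; split=> [|x y Lx Ly|a x Lx] /=.
  + by rewrite rmorph0.
  + by rewrite rmorphD; apply: LD.
  + by rewrite rmorphM; apply: (LZ (pi a)).
- exact: Ldec.
- by exists N => n /NP LN y; have [x <-] := pi_surj y => /LN.
Qed.

Lemma center_finite_quotient : center_finite A -> center_finite B.
Proof.
move=> [n [g gP]]; exists n, (pi \o g) => y; have [x <-] := pi_surj y.
have [c [cZ ->]] := gP x; exists (pi \o c); split=> [i z|] /=.
  by have [w <-] := pi_surj z; rewrite -!rmorphM cZ.
by rewrite rmorph_sum; apply: eq_bigr => i _; rewrite rmorphM.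
Qed.

End Quotient.

(** * Quasi-heredity *)

Lemma quotient_ring_exists (A : pzRingType) (J : submodClosed A^o) :
  two_sided J ->
  exists (B : pzRingType) (pi : {rmorphism A -> B}),
    (forall b, exists a, pi a = b) /\ (forall a, pi a = 0 <-> a \in J).
Proof.
move=> J2; have sJ := submodClosed_submod J.
pose P : {pred A^o} := fun x => x \in J.
have P_closed : zmod_closed P by split; [case: sJ|exact: (submodB sJ)].
pose Jz : zmodClosed A^o := HB.pack P (GRing.isZmodClosed.Build A^o P P_closed).
pose Q : zmodType := Quotient.quot Jz.
pose q (a : A) : Q := (\pi_(Quotient.quot Jz) (a : A^o))%qT.
pose r (x : Q) : A := (repr (x : Quotient.quot Jz))%qT.
have rK x : q (r x) = x by apply: reprK.
have qE a b : q a = q b <-> a - b \in J.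
  by rewrite -[_ \in J]/((a : A^o) - b \in Jz) (Quotient.idealrBE Jz); split=> /eqP.
have qr_sub a : r (q a) - a \in J by apply/qE; rewrite rK.
have qD a b : q (a + b) = q a + q b by exact: (Quotient.pi_add Jz a b).
have q0 : q 0 = 0 by apply: (addrI (q 0)); rewrite -qD !addr0.
have qB : zmod_morphism q.
  by move=> a b; apply: (addIr (q b)); rewrite -qD !subrK.
pose mul (x y : Q) : Q := q (r x * r y).
have qM a b : q (a * b) = mul (q a) (q b).
  apply/esym/qE; rewrite (_ : _ - _ = (r (q a) - a) * r (q b) + a * (r (q b) - b)).
    by apply: rpredD; [apply: J2|apply: (rpredZ a)].
  by rewrite mulrBl mulrBr addrA subrK.
have mulA : associative mul.
  by move=> x y z; rewrite -[x]rK -[y]rK -[z]rK -!qM mulrA.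
have mul1 : left_id (q 1) mul by move=> x; rewrite -[x]rK -qM mul1r.
have mulr1 : right_id (q 1) mul by move=> x; rewrite -[x]rK -qM mulr1.
have mulDl : left_distributive mul +%R.
  by move=> x y z; rewrite -[x]rK -[y]rK -[z]rK -qD -!qM -qD mulrDl.
have mulDr : right_distributive mul +%R.
  by move=> x y z; rewrite -[x]rK -[y]rK -[z]rK -qD -!qM -qD mulrDr.
pose B : pzRingType := HB.pack (Q : Type) (GRing.Zmodule.class Q)
  (GRing.Zmodule_isPzRing.Build Q mulA mul1 mulr1 mulDl mulDr).
pose qz := GRing.isZmodMorphism.Build A B q qB.
have qmon : monoid_morphism (q : A -> B) by split=> // a b; apply: qM.
pose qm := GRing.isMonoidMorphism.Build A B q qmon.
pose pi : {rmorphism A -> B} := HB.pack (q : A -> B) qz qm.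
exists B, pi; split=> [b|a]; first by exists (r b); apply: rK.
by rewrite -[a in a \in J]subr0 -qE q0.
Qed.

(** Heredity chains are built by artinian induction on a left ideal [L] that
    still maps onto the current quotient [B] of [A]: factoring out [B e B]
    lets [L] shrink to its elements [x] with [pi x * e = 0]. *)
Lemma quasi_heredity (A : pzRingType) :
  artinian A^o -> kernels_projective A -> center_finite A -> quasi_hereditary A.
Proof.
move=> artA kpA cfA.
pose chain_from (B : pzRingType) (pi : A -> B) :=
  exists (m : nat) (J : nat -> submodClosed A^o),
    [/\ forall t, (t <= m)%N -> two_sided (J t),
        forall x, x \in J 0%N <-> pi x = 0,
        forall x, x \in J m,
        forall t, (t < m)%N -> {subset J t <= J t.+1} &
        forall t, (t < m)%N -> heredity_step (J t) (J t.+1)].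
pose chain_below (L : set A^o) := forall (B : pzRingType) (pi : {rmorphism A -> B}),
  (forall b, exists a, pi a = b) -> kernels_projective B ->
  (exists2 l, L l & pi l = 1) -> chain_from B pi.
suff chain L : is_submod L -> chain_below L.
  have sT : is_submod (setT : set A^o) by [].
  by apply: (chain setT sT A idfun) => //; [move=> a; exists a|exists 1].
move=> sL; apply: contrapT => nL.
have [||L0] := artinian_min artA (Q := [set L | is_submod L /\ ~ chain_below L]).
- by move=> ? [].
- by exists L.
move=> [sL0 +] L0min; apply=> B pi pi_surj kpB [l0 Ll0 l0E].
pose kerpi := [set x : A^o | pi x = 0].
have sker : is_submod kerpi.
  split=> [|x y x0 y0|a x x0]; rewrite /kerpi /=; first exact: rmorph0.
    by rewrite rmorphD x0 y0 addr0.
  by rewrite scale_regularE rmorphM x0 mulr0.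
have [J0 J0P] := submodP sker.
have J0_two_sided : two_sided J0.
  by move=> x a /J0P x0; apply/J0P; rewrite /kerpi /= rmorphM x0 mul0r.
have [B0|B_nz] := pselect ((1 : B) = 0).
  exists 0%N, (fun=> J0); split=> // x; apply/J0P.
  by rewrite /kerpi /= -[x]mul1r rmorphM rmorph1 B0 mul0r.
have artB : artinian B^o by apply: (artinian_quotient pi_surj).
have cfB : center_finite B by apply: (center_finite_quotient pi_surj).
have [e [H [ee e_nz HP dbH herH]]] := heredity_ideal_exists artB kpB cfB B_nz.
have H_two_sided : two_sided H by case: herH.
have [B' [rho [rho_surj rho_ker]]] := quotient_ring_exists H_two_sided.
pose pi' : {rmorphism A -> B'} := rho \o pi.
have pi'_surj b : exists a, pi' a = b.
  by have [c <-] := rho_surj b; have [a <-] := pi_surj c; exists a.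
have kpB' : kernels_projective B'.
  apply: (kernels_projective_quotient rho_surj _ (idem_ideal_submod e)) dbH kpB => [b|x a|x].
  - by rewrite rho_ker.
  - exact: idem_ideal_two_sided.
  - exact: idem_ideal_idempotent.
pose L' := [set x : A^o | L0 x /\ pi x * e = 0].
have sL' : is_submod L'.
  case: sL0 => L00 L0D L0Z; split=> [|x y [Lx x0] [Ly y0]|a x [Lx x0]]; split.
  - exact: L00.
  - by rewrite rmorph0 mul0r.
  - exact: L0D.
  - by rewrite rmorphD mulrDl x0 y0 addr0.
  - exact: L0Z.
  - by rewrite scale_regularE rmorphM -mulrA x0 mulr0.
have [m [J [J2 JB Jm Jmono Jher]]] : chain_from B' pi'.
  apply: contrapT => nchain.
  have [||_] := L0min L' _ _ l0 Ll0.
  - split=> // H'; apply: nchain; apply: H' => //.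
    (* For a over e, this element of L0 maps to 1 - e: it is annihilated by e
       and becomes 1 modulo B e B. *)
    have [a aE] := pi_surj e; exists (l0 - a * l0 : A).
      split; last by rewrite rmorphB rmorphM l0E aE mulr1 mulrBl mul1r ee subrr.
      by apply: submodB => //; case: sL0 => _ _ L0Z; apply: (L0Z a).
    rewrite rmorphB rmorphM -[RHS]subr0; congr (_ - _); first by rewrite /= l0E rmorph1.
    rewrite /= l0E aE rmorph1 mulr1; apply/rho_ker/HP.
    have := idem_ideal_gen e 1 1; by rewrite mul1r mulr1.
  - by move=> x [].
  - by rewrite l0E mul1r.
have JBP x : x \in J 0%N <-> idem_ideal e (pi x) by rewrite JB /= rho_ker HP.
exists m.+1, (fun t => if t is t'.+1 then J t' else J0); split=> //.
- by case.
- case=> [_|t]; last exact: Jmono.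
  move=> x /J0P x0; apply/JBP; rewrite x0.
  by case: (idem_ideal_submod e).
- case=> [_|t]; last exact: Jher.
  exists B, pi, H; split=> //; first by move=> a; rewrite J0P.
  move=> b; rewrite HP; split=> [|[a /JBP Ja <-] //].
  by have [a <-] := pi_surj b => /JBP Ja; exists a.
Qed.

(** * Finitely generated modules over artinian rings *)

(** Induction on the number of generators: a chain of submodules is controlled
    by its traces on the span of the first [k] generators and by the left
    ideals of the coefficients at the next one. *)
Lemma fin_gen_artinian (A : pzRingType) (V : lmodType A) :
  artinian A^o -> fin_gen V -> artinian V.
Proof.
move=> artA [n [g g_gen]] L sL Ldec.
have Lanti (L' : nat -> set V) : (forall k, L' k.+1 `<=` L' k) ->
    forall k l, (k <= l)%N -> L' l `<=` L' k.
  move=> L'dec k l /subnK <-; elim: (l - k)%N => // d IHd x Lx.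
  by apply: IHd; apply: L'dec.
(* Generators are indexed by [nat], padded by 0, so that the induction can
   stop at any [k]. *)
pose span k : set V := [set x | exists c : nat -> A,
  x = \sum_(i < k) c i *: (if insub (i : nat) is Some j then g j else 0)].
have {g_gen} : forall x, span n x.
  move=> x; have [c ->] := g_gen x.
  exists (fun i => if insub i is Some j then c j else 0).
  by apply: eq_bigr => i _; rewrite valK.
suff stab k (L' : nat -> set V) : (forall n, is_submod (L' n)) ->
    (forall n, L' n.+1 `<=` L' n) -> (forall n, L' n `<=` span k) ->
    exists N, forall n, (N <= n)%N -> L' N `<=` L' n.
  by move=> spanT; apply: (stab n) => // l x _; apply: spanT.
elim: k L' {L sL Ldec} => [|k IHk] L sL Ldec Lspan.
  exists 0%N => l _ x /Lspan[c]; rewrite big_ord0 => ->.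
  by case: (sL l).
set gk : V := if insub k is Some j then g j else 0.
have sspan : is_submod (span k).
  split=> [|_ _ [c ->] [d ->]|a _ [c ->]].
  - by exists (fun=> 0); rewrite big1 // => i _; rewrite scale0r.
  - exists (fun i => c i + d i); rewrite -big_split; apply: eq_bigr => i _.
    by rewrite scalerDl.
  - exists (fun i => a * c i); rewrite scaler_sumr; apply: eq_bigr => i _.
    by rewrite scalerA.
case: (sspan) => S0 SD SZ.
pose I l : set A^o := [set r | exists2 x, span k x & L l (x + r *: gk)].
have [l|l r [x Sx /Ldec Lx]|N1 N1P] := artA I.
- case: (sL l) => L0 LD LZ; split=> [|r r' [x Sx Lx] [y Sy Ly]|a r [x Sx Lx]].
  + by exists 0 => //; rewrite scale0r addr0.
  + by exists (x + y); [apply: SD|rewrite scalerDl addrACA; apply: LD].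
  + by exists (a *: x); [apply: SZ|rewrite -scalerA -scalerDr; apply: LZ].
- by exists x.
have [l|l x [/Ldec Lx Sx] //|l x [] //|N2 N2P] := IHk (fun l => [set x | L l x /\ span k x]).
  case: (sL l) => L0 LD LZ; split=> [//|x y [? ?] [? ?]|a x [? ?]]; split.
  - exact: LD.
  - exact: SD.
  - exact: LZ.
  - exact: SZ.
exists (maxn N1 N2) => l; rewrite geq_max => /andP[N1l N2l] x Lx.
have [c] := Lspan _ _ Lx; rewrite big_ord_recr /= -/gk.
set x0 := \sum_(i < k) _ => xE.
have Sx0 : span k x0 by exists c.
have /(N1P _ N1l)[y Sy Ly] : I N1 (c k).
  by exists x0 => //; rewrite -xE; apply: (Lanti _ Ldec) Lx; apply: leq_maxl.
have Lxy : L (maxn N1 N2) (x - (y + c k *: gk)).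
  apply: submodB => //; apply: (Lanti _ Ldec) Ly; by rewrite geq_max N1l.
have [|Ll _] := N2P l N2l (x - (y + c k *: gk)).
- split; first by apply: (Lanti _ Ldec) Lxy; apply: leq_maxr.
  by rewrite xE opprD addrACA subrr addr0; apply: submodB.
by rewrite -[x](subrK (y + c k *: gk)); case: (sL l) => _ LD _; apply: LD.
Qed.

Lemma commutative_artin_artinian (R : comPzRingType) :
  commutative_artin R -> artinian R^o.
Proof.
move=> artR L sL Ldec.
have /choice[S SP] : forall n, exists S : submodClosed R^o, forall x, x \in S <-> L n x.
  by move=> n; apply: submodP.
have [|N NP] := artR S; first by move=> n x /SP/Ldec/SP.
by exists N => n /NP SN x /SP; rewrite -SN => /SP.
Qed.

(** * The endomorphism ring of an object *)

Section Composition.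
Variables (R : comPzRingType) (C : rcategory R).

Lemma comp_suml (X Y Z : C) (I : Type) (r : seq I) (F : I -> hom C Y Z) (f : hom C X Y) :
  comp C (\sum_(i <- r) F i) f = \sum_(i <- r) comp C (F i) f.
Proof. by elim/big_rec2: _ => [|i _ y _ <-]; rewrite ?comp0l ?compDl. Qed.

Lemma comp_sumr (X Y Z : C) (I : Type) (r : seq I) (g : hom C Y Z) (F : I -> hom C X Y) :
  comp C g (\sum_(i <- r) F i) = \sum_(i <- r) comp C g (F i).
Proof. by elim/big_rec2: _ => [|i _ y _ <-]; rewrite ?comp0r ?compDr. Qed.

(** A finite power of [X], of which only the orthogonality of the injections
    and projections is recorded. *)
Lemma power_exists (I : finType) (X : C) : additive_category C ->
  exists (S : C) (inj : I -> hom C X S) (prj : I -> hom C S X),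
    forall i j, comp C (prj i) (inj j) = if i == j then id1 C X else 0.
Proof.
move=> [[Z _] biprod].
suff [S [inj [prj prj_inj]]] : exists (S : C) (inj : 'I_#|I| -> hom C X S)
    (prj : 'I_#|I| -> hom C S X),
    forall i j, comp C (prj i) (inj j) = if i == j then id1 C X else 0.
  exists S, (fun i => inj (enum_rank i)), (fun i => prj (enum_rank i)) => i j.
  by rewrite prj_inj (inj_eq enum_rank_inj).
elim: #|I| => [|n [S [inj [prj prj_inj]]]].
  by exists Z, (fun=> 0), (fun=> 0) => -[].
have [T [i [j [p [q [pi qj pj qi _]]]]]] := biprod X S.
exists T, (fun k => if unlift ord0 k is Some l then comp C j (inj l) else i),
  (fun k => if unlift ord0 k is Some l then comp C (prj l) q else p) => k l.
case: (unliftP ord0 k) => [k' ->|->]; case: (unliftP ord0 l) => [l' ->|->].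
- by rewrite -compA (compA q) qj comp1l prj_inj (inj_eq lift_inj).
- by rewrite -compA qi comp0r eq_sym (negbTE (neq_lift _ _)).
- by rewrite compA pj comp0l (negbTE (neq_lift _ _)).
- by rewrite eqxx.
Qed.

Section Precompose.
Variables (X Y : C) (f : hom C X Y).

Definition precompose (Z : C) (u : rep Y Z) : rep X Z := comp C u f.

Lemma precompose_zmod Z : zmod_morphism (@precompose Z).
Proof. by move=> u v; rewrite /precompose compDl -scaleN1r compZl scaleN1r. Qed.

HB.instance Definition _ Z :=
  GRing.isZmodMorphism.Build (rep Y Z) (rep X Z) (@precompose Z) (@precompose_zmod Z).

Lemma precompose_nat Z W (g : hom C Z W) u :
  precompose (fmap (rep Y) g u) = fmap (rep X) g (precompose u).
Proof. by rewrite /precompose /= /rep_map compA. Qed.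

Definition rep_nt : nattrans (rep Y) (rep X) :=
  @NatTrans R C (rep Y) (rep X) (fun Z => @precompose Z) precompose_nat.

End Precompose.

Lemma nattrans_repE (X : C) (F : afunctor C) (t : nattrans (rep X) F) Y (u : hom C X Y) :
  t Y u = fmap F u (t X (id1 C X)).
Proof. by rewrite -nt_nat /= /rep_map comp1r. Qed.

End Composition.

Section EndomorphismRing.
Variables (R : comPzRingType) (C : rcategory R) (X : C).

Local Notation A := (endo (rep X))^c.

(** The Yoneda bijection; multiplication in the converse ring becomes
    composition in the category. *)
Definition endo_hom (x : A) : hom C X X := (x : nattrans (rep X) (rep X)) X (id1 C X).
Definition hom_endo (f : hom C X X) : A := rep_nt f.

Lemma hom_endoK : cancel hom_endo endo_hom.
Proof. by move=> f; rewrite /endo_hom /= /precompose comp1l. Qed.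

Lemma endo_homK : cancel endo_hom hom_endo.
Proof.
move=> x; apply: nattrans_ext => Y u; rewrite /= /precompose.
by rewrite [RHS]nattrans_repE.
Qed.

Lemma endo_homD x y : endo_hom (x + y) = endo_hom x + endo_hom y.
Proof. by []. Qed.

Lemma endo_homM x y : endo_hom (x * y) = comp C (endo_hom x) (endo_hom y).
Proof. by rewrite {1}/endo_hom /= [LHS]nattrans_repE. Qed.

Lemma endo_hom0 : endo_hom 0 = 0.
Proof. by []. Qed.

Lemma endo_hom_sum (I : Type) (r : seq I) (F : I -> A) :
  endo_hom (\sum_(i <- r) F i) = \sum_(i <- r) endo_hom (F i).
Proof. by elim/big_rec2: _ => [|i _ y _ <-]. Qed.

Lemma endo_hom_inj : injective endo_hom.
Proof. exact: can_inj endo_homK. Qed.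

Lemma endo_artinian :
  commutative_artin R -> fin_gen (hom C X X) -> artinian A^o.
Proof.
move=> artR fgX L sL Ldec.
have artH := fin_gen_artinian (commutative_artin_artinian artR) fgX.
have [n|n f|N NP] := artH (fun n => [set f | L n (hom_endo f)]).
- case: (sL n) => L0 LD LZ; split=> [|f g Lf Lg|a f Lf] /=.
  + by rewrite (_ : hom_endo 0 = 0) //; apply: endo_hom_inj; rewrite hom_endoK.
  + rewrite (_ : hom_endo _ = hom_endo f + hom_endo g); first exact: LD.
    by apply: endo_hom_inj; rewrite endo_homD !hom_endoK.
  + rewrite (_ : hom_endo _ = hom_endo (a *: id1 C X) * hom_endo f); first exact: LZ.
    by apply: endo_hom_inj; rewrite endo_homM !hom_endoK compZl comp1l.
- exact: Ldec.
- exists N => n /NP LN x Lx; rewrite -[x]endo_homK; apply: LN.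
  by rewrite /= endo_homK.
Qed.

Lemma endo_center_finite : fin_gen (hom C X X) -> center_finite A.
Proof.
move=> [n [g gP]]; exists n, (fun i => hom_endo (g i)) => y.
have [c yE] := gP (endo_hom y); exists (fun i => hom_endo (c i *: id1 C X)).
split=> [i x|]; apply: endo_hom_inj.
  by rewrite !endo_homM hom_endoK compZl compZr comp1l comp1r.
rewrite yE endo_hom_sum; apply: eq_bigr => i _.
by rewrite endo_homM !hom_endoK compZl comp1l.
Qed.

(** Generators of [Hom(K,X)] define an epimorphism from [Hom(X^n,-)] to the
    trace ideal [I(K,-)], which splits by projectivity. As [I(K,X)] is all of
    [Hom(K,X)], the splitting at [X] is a dual basis of [Hom(K,X)] over
    [End(X)]. *)
Lemma hom_dual_basis (K : C) :
  additive_category C -> fin_gen (hom C K X) ->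
  projective_functor (trace_ideal (rep X) K) ->
  exists (n : nat) (h : 'I_n -> hom C K X) (s : 'I_n -> hom C K X -> hom C X X),
    [/\ forall l u v, s l (u + v) = s l u + s l v,
        forall l g u, s l (comp C g u) = comp C g (s l u) &
        forall u, \sum_l comp C (s l u) (h l) = u].
Proof.
move=> addC [n [h h_gen]] proj.
have [U [inj [prj prj_inj]]] := power_exists 'I_n X addC.
pose hU : hom C K U := \sum_l comp C (inj l) (h l).
have in_trace Y (u : hom C U Y) : comp C u hU \in @trace_pred R C (rep X) (rep K) Y.
  apply/asboolP; exists n, (fun l => rep_nt (h l)), (fun l => comp C u (inj l)).
  by rewrite /hU comp_sumr; apply: eq_bigr => l _; rewrite compA.
pose q_ Y (u : rep U Y) : trace_ideal (rep X) K Y := exist _ (comp C u hU) (in_trace Y u).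
have q_zmod Y : zmod_morphism (@q_ Y).
  move=> u v; apply: val_inj; rewrite /= compDl; congr (_ + _).
  by rewrite -scaleN1r compZl scaleN1r.
pose q_add Y : {additive rep U Y -> trace_ideal (rep X) K Y} :=
  HB.pack (@q_ Y) (GRing.isZmodMorphism.Build _ _ (@q_ Y) (@q_zmod Y)).
have q_nat Y Z (f : hom C Y Z) u :
    q_add Z (fmap (rep U) f u) = fmap (trace_ideal (rep X) K) f (q_add Y u).
  by apply: val_inj; rewrite /= /rep_map compA.
pose q := NatTrans q_nat.
have q_epi : nt_epi q.
  move=> Y [y y_in]; have /asboolP[m [phi [x yE]]] := y_in.
  have /choice[c cP] : forall k, exists c : 'I_n -> R, phi k X (id1 C X) = \sum_l c l *: h l.
    by move=> k; apply: h_gen.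
  exists (\sum_k comp C (x k) (\sum_l c k l *: prj l)); apply: val_inj => /=.
  rewrite [RHS]yE comp_suml; apply: eq_bigr => k _.
  rewrite [RHS]nattrans_repE /= /rep_map cP -compA; congr (comp C _ _).
  rewrite comp_suml; apply: eq_bigr => l _.
  rewrite compZl; congr (_ *: _); rewrite /hU comp_sumr (bigD1 l) //= big1.
    by rewrite addr0 compA prj_inj eqxx comp1l.
  by move=> l' l'l; rewrite compA prj_inj eq_sym (negbTE l'l) comp0l.
have [sigma sigmaP] := proj _ _ q (nt_id _) q_epi.
have all_in (u : hom C K X) : u \in @trace_pred R C (rep X) (rep K) X.
  apply/asboolP; exists 1%N, (fun=> rep_nt u), (fun=> id1 C X).
  by rewrite big_ord1 /= /precompose comp1l.
pose tr u : trace_ideal (rep X) K X := exist _ u (all_in u).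
exists n, h, (fun l u => comp C (sigma X (tr u)) (inj l)); split=> [l u v|l g u|u].
- rewrite (_ : tr (u + v) = tr u + tr v); last exact: val_inj.
  by rewrite raddfD compDl.
- rewrite (_ : tr (comp C g u) = fmap (trace_ideal (rep X) K) g (tr u)).
    by rewrite nt_nat /= /rep_map compA.
  exact: val_inj.
- pose I := trace_ideal (rep X) K.
  have uE : comp C (sigma X (tr u)) hU = u.
    by have := congr1 (fun t : nattrans I I => sval (t X (tr u))) sigmaP.
  rewrite -[RHS]uE /hU comp_sumr; apply: eq_bigr => l _; by rewrite compA.
Qed.

(** A row killed by a matrix over [End(X)] is a map [X^I -> X] that kills the
    corresponding map [f : X^J -> X^I], so the kernel of the matrix is
    [Hom(coker f, X)], which has a dual basis by [hom_dual_basis]. *)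
Lemma endo_kernels_projective :
  additive_category C -> with_cokernels C ->
  (forall K : C, fin_gen (hom C K X)) ->
  (forall K : C, projective_functor (trace_ideal (rep X) K)) ->
  kernels_projective A.
Proof.
move=> addC coker fg proj I J M.
have [S [injI [prjI prj_injI]]] := power_exists I X addC.
have [T [injJ [prjJ prj_injJ]]] := power_exists J X addC.
pose col j : hom C X S := \sum_i comp C (injI i) (endo_hom (M i j)).
pose f : hom C T S := \sum_j comp C (col j) (prjJ j).
have f_inj j : comp C f (injJ j) = col j.
  rewrite /f comp_suml (bigD1 j) //= big1 => [|j' j'j].
    by rewrite addr0 -compA prj_injJ eqxx comp1r.
  by rewrite -compA prj_injJ (negbTE j'j) comp0r.
have [K [c [cf c_univ]]] := coker _ _ f.
have [n [h [s [sD sM sP]]]] := hom_dual_basis addC (fg K) (proj K).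
pose row (x : {ffun I -> A^o}) : hom C S X := \sum_i comp C (endo_hom (x i)) (prjI i).
have row_inj x i : comp C (row x) (injI i) = endo_hom (x i).
  rewrite /row comp_suml (bigD1 i) //= big1 => [|i' i'i].
    by rewrite addr0 -compA prj_injI eqxx comp1r.
  by rewrite -compA prj_injI (negbTE i'i) comp0r.
have row_col x j : comp C (row x) (col j) = endo_hom (\sum_i (x i : A) * M i j).
  rewrite /col comp_sumr endo_hom_sum; apply: eq_bigr => i _.
  by rewrite compA row_inj endo_homM.
have row_f x : matrix_kernel M x -> comp C (row x) f = 0.
  by move=> Mx; rewrite /f comp_sumr big1 // => j _; rewrite compA row_col Mx comp0l.
have c_epi (u v : hom C K X) : comp C u c = comp C v c -> u = v.
  move=> uv; have [|w [_ w_uniq]] := c_univ X (comp C u c).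
    by rewrite -compA cf comp0r.
  by rewrite -(w_uniq u) // -(w_uniq v).
have /choice[fac facP] : forall x : {ffun I -> A^o}, exists u : hom C K X,
    matrix_kernel M x -> comp C u c = row x.
  move=> x; have [Mx|nMx] := pselect (matrix_kernel M x).
    by have [u [uE _]] := c_univ X (row x) (row_f x Mx); exists u.
  by exists 0.
have ker_comp (u : hom C K X) j :
    \sum_i hom_endo (comp C u (comp C c (injI i))) * M i j = 0.
  apply: endo_hom_inj; rewrite endo_hom_sum endo_hom0.
  rewrite (eq_bigr (fun i => comp C (comp C u c) (comp C (injI i) (endo_hom (M i j))))).
    by rewrite -comp_sumr -/(col j) -f_inj compA -(compA u) cf comp0r comp0l.
  by move=> i _; rewrite endo_homM hom_endoK !compA.
have [_ kerD kerZ] := matrix_kernel_submod M.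
exists 'I_n, (fun l => [ffun i => hom_endo (comp C (h l) (comp C c (injI i)))]),
  (fun l x => hom_endo (s l (fac x))).
split=> [l j|l|x Mx].
- rewrite -[RHS](ker_comp (h l) j); apply: eq_bigr => i _; by rewrite ffunE.
- split=> [x y Mx My|a x Mx]; apply: endo_hom_inj.
    rewrite endo_homD !hom_endoK -sD; congr (s l _); apply: c_epi.
    rewrite facP; last exact: kerD.
    rewrite compDl !facP // /row -big_split; apply: eq_bigr => i _.
    by rewrite ffunE endo_homD compDl.
  rewrite endo_homM !hom_endoK -sM; congr (s l _); apply: c_epi.
  rewrite facP; last exact: kerZ.
  rewrite -compA facP // /row comp_sumr; apply: eq_bigr => i _.
  by rewrite ffunE endo_homM compA.
- apply/ffunP => i; apply: endo_hom_inj; rewrite sum_ffunE endo_hom_sum.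
  rewrite -row_inj -(facP x Mx) -[in RHS](sP (fac x)) !comp_suml.
  by apply: eq_bigr => l _; rewrite !ffunE endo_homM !hom_endoK !compA.
Qed.

End EndomorphismRing.

Theorem proposition8p13 (R : comPzRingType) (C : rcategory R) (C0 : C) :
  commutative_artin R ->
  dualizing_variety C ->
  with_cokernels C ->
  (forall C' : C, projective_functor (trace_ideal (rep C0) C')) ->
  quasi_hereditary (endo (rep C0))^c.
Proof.
move=> artR [[addC _ fgC] _] coker proj.
apply: quasi_heredity.
- exact: endo_artinian.
- by apply: endo_kernels_projective.
- exact: endo_center_finite.
Qed.
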